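(* There is an algorithm that decides the following problem, restricted to instances in which $f$ and $g$ are both monic and both split completely over some quadratic (degree-two) extension $\mathbb{K}$ of $\mathbb{Q}$. Input: polynomials $f,g\in\mathbb{Z}[x]$, where $f$ has no non-negative integer zeros, an initial value $u_0\in\mathbb{Q}$, and a target $t\in\mathbb{Q}$. Question: letting $\langle u_n\rangle_{n=0}^\infty$ be the unique sequence of rationals with the given $u_0$ and $f(n)u_n-g(n)u_{n-1}=0$ for all $n\ge 1$, does there exist $n\in\mathbb{N}$ with $u_n=t$?
   Context: A hypergeometric sequence is a rational-valued sequence $\langle u_n\rangle_{n=0}^\infty$ satisfying $f(n)u_n = g(n)u_{n-1}$ for all $n\geq 1$, with $f,g\in\mathbb{Z}[x]$ and $f$ having no non-negative integer zeros; it is determined by $f$, $g$ and $u_0$. The problem above is the Membership Problem for such sequences. *)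

(* Defs.v *)
From HB Require Import structures.
From mathcomp Require Import all_boot all_order all_algebra all_field.

Set Implicit Arguments.
Unset Strict Implicit.
Unset Printing Implicit Defensive.

Import Order.TTheory GRing.Theory Num.Theory.
Local Open Scope ring_scope.

(* A Rocq term of type [instance -> bool] is not evidence of an algorithm once
   choice axioms are available, so algorithms are programs of an explicit model
   of computation: Kleene's partial recursive functions. *)
Inductive recfun : nat -> Type :=
| RZero n : recfun n
| RSucc : recfun 1
| RProj n (i : 'I_n) : recfun n
| RComp m n (e : recfun m) (es : 'I_m -> recfun n) : recfun n
| RRec n (e : recfun n) (h : recfun n.+2) : recfun n.+1
| RMu n (e : recfun n.+1) : recfun n.

(* [computes e v y]: the program e halts on input v with output y.  For
   primitive recursion, the existentially quantified s is the sequence of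
   intermediate values; the recursion argument comes first in v, and the step
   receives the index, the previous value and then the parameters. *)
Fixpoint computes n (e : recfun n) : n.-tuple nat -> nat -> Prop :=
  match e in recfun n return n.-tuple nat -> nat -> Prop with
  | RZero _ => fun v y => y = 0%N
  | RSucc => fun v y => y = (tnth v ord0).+1
  | RProj _ i => fun v y => y = tnth v i
  | RComp m _ e es => fun v y => exists w : m.-tuple nat,
      (forall i, computes (es i) v (tnth w i)) /\ computes e w y
  | RRec _ e h => fun v y => exists s : nat -> nat,
      [/\ computes e [tuple of behead v] (s 0%N),
          forall i, (i < thead v)%N ->
            computes h [tuple of i :: s i :: behead v] (s i.+1)
        & y = s (thead v)]
  | RMu _ e => fun v y =>
      computes e [tuple of y :: v] 0%N /\
      forall i, (i < y)%N -> exists z, computes e [tuple of i :: v] z.+1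
  end.

Lemma computes_functional n (e : recfun n) (v : n.-tuple nat) (y z : nat) :
  computes e v y -> computes e v z -> y = z.
Proof.
elim: e v y z => {n} [n|| n i | m n e IHe es IHes | n e IHe h IHh | n e IHe] v y z /=.
- by move=> -> ->.
- by move=> -> ->.
- by move=> -> ->.
- move=> [w [Hw He]] [w' [Hw' He']].
  have E : w = w' by apply: eq_from_tnth => i; apply: IHes (Hw i) (Hw' i).
  by rewrite -E in He'; apply: IHe He He'.
- move=> [s [s0 sS ->]] [s' [s'0 s'S ->]].
  suff E i : (i <= thead v)%N -> s i = s' i by exact: E.
  elim: i => [_|i IHi lti]; first exact: IHe s0 s'0.
  have := s'S i lti; rewrite -(IHi (ltnW lti)) => H'.
  exact: IHh (sS i lti) H'.
- move=> [y0 ylt] [z0 zlt].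
  case: (ltngtP y z) => // [lt | lt].
    by have [k Hk] := zlt _ lt; have := IHe _ _ _ y0 Hk.
  by have [k Hk] := ylt _ lt; have := IHe _ _ _ z0 Hk.
Qed.

Definition code_int (z : int) : nat :=
  match z with Posz n => n.*2 | Negz n => n.*2.+1 end.

(* Coefficients, constant term first. *)
Definition code_poly (p : {poly int}) : nat :=
  CodeSeq.code [seq code_int c | c <- polyseq p].

Definition code_rat (q : rat) : nat :=
  CodeSeq.code [:: code_int (numq q); code_int (denq q)].

Definition hypergeometric (f g : {poly int}) (u0 : rat) (u : nat -> rat) : Prop :=
  u 0%N = u0 /\
  forall n : nat, (1 <= n)%N ->
    (f.[n%:Z])%:~R * u n - (g.[n%:Z])%:~R * u n.-1 = 0.

Definition no_nat_zero (f : {poly int}) : Prop := forall n : nat, f.[n%:Z] != 0.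

Lemma hypergeometric_exists_unique (f g : {poly int}) (u0 : rat) :
  no_nat_zero f ->
  exists u, hypergeometric f g u0 u /\
    forall v, hypergeometric f g u0 v -> v =1 u.
Proof.
move=> f0.
have nz n : (f.[n%:Z])%:~R != 0 :> rat by rewrite intr_eq0.
pose u := fix u n : rat := if n is m.+1
  then (g.[n%:Z])%:~R * u m / (f.[n%:Z])%:~R else u0.
exists u; split.
  split=> // -[//|n] _ /=; apply/eqP.
  by rewrite subr_eq0 mulrC divfK.
move=> v [v0 vS]; elim=> [//|n IHn].
apply: (mulfI (nz n.+1)); move/eqP: (vS n.+1 isT); rewrite subr_eq0 => /eqP ->.
by rewrite /= -/(u n) IHn [RHS]mulrC divfK.
Qed.

Definition membership (f g : {poly int}) (u0 t : rat) : Prop :=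
  exists u : nat -> rat, hypergeometric f g u0 u /\ exists n : nat, u n = t.

Definition splits_over (K : fieldExtType rat) (p : {poly int}) : Prop :=
  exists rs : seq K,
    map_poly (fun z : int => z%:~R) p %= \prod_(r <- rs) ('X - r%:P).

(* Main.v *)
(* With T1 = num(u0) den(t) and T2 = num(t) den(u0), the equation u_n = t reads
   T1 g(1)...g(n) = T2 f(1)...f(n).  It suffices to bound, by an explicit
   computable function of the input, the least solution n; the algorithm then
   tests all smaller indices.

   If deg f <> deg g, one product eventually outgrows the other.  Otherwise f^2
   and g^2 are products of integer quadratics x^2 - a x + c, one for each root
   and its conjugate, with discriminants D in a single square class.  If f and g
   have the same discriminants with multiplicity, the quadratics match up to
   integer shifts, the products telescope, and n is a root of an explicit integer
   polynomial, which vanishes identically only if f = g.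

   Otherwise let D0 <> 0 be of least absolute value among the discriminants with
   different multiplicities in f and g, and let x^2 - a x + c have discriminant
   D0.  For large n some prime p > 6Wn (W bounds the data) divides k^2 - a k + c
   for a k slightly below n.  For a root with discriminant D in the same square
   class, p can divide the quadratic at an index k' only if
   (2k' - a')/(2k - a) = sqrt(D/D0) exactly.  So quadratics with |D| > |D0|
   contribute nothing to the p-adic valuation of the products, quadratics with
   the same D contribute equally, and the valuations of the two sides differ.

   The prime p comes from Chebyshev's argument for the largest prime factor of
   prod (k^2 + 1): on an interval of length N proportional to n, the product of
   the values of the quadratic is about n^(2N), whereas primes p <= 6Wn account
   for about n^N only, because the primes with D a square modulo p satisfy
   sum_{p <= N} ln p / p <= (ln N) / 2 + O(1).  This last bound follows from
   comparing the size of prod |N(v - w)|, over distinct v, w in a box of side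
   sqrt N, N(x, y) = x^2 - D y^2, with its p-adic valuations, bounded below by
   counting the pairs that collide under (x, y) |-> x +- s y mod p. *)
Require Import Defs.
From mathcomp Require Import all_boot all_order all_algebra all_field.
From mathcomp Require Import zify ring lra.
From mathcomp Require Import boolp reals exp Rstruct.

Set Implicit Arguments.
Unset Strict Implicit.
Unset Printing Implicit Defensive.

Import Order.TTheory GRing.Theory Num.Theory.
Local Open Scope ring_scope.

(** * Computable functions *)

Section Computable.
Local Open Scope nat_scope.

Definition computable n (F : n.-tuple nat -> nat) : Prop :=
  exists e : recfun n, forall v, computes e v (F v).

Lemma computable_ext n (F G : n.-tuple nat -> nat) :
  F =1 G -> computable F -> computable G.
Proof. by move=> eFG [e He]; exists e => v; rewrite -eFG. Qed.

Lemma computable_proj n (i : 'I_n) : computable (fun v : n.-tuple nat => tnth v i).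
Proof. by exists (RProj i). Qed.

Lemma computable_comp m n (G : m.-tuple nat -> nat)
    (H : 'I_m -> n.-tuple nat -> nat) :
  computable G -> (forall i, computable (H i)) ->
  computable (fun v => G [tuple H i v | i < m]).
Proof.
move=> [e He] HH.
(* Since ['I_m] is finite, the component programs can be selected together without a choice
   axiom. *)
have [es Hes] := fin_all_exists HH.
exists (RComp e es) => v /=; exists [tuple H i v | i < m]; split=> [i|//].
by rewrite tnth_mktuple.
Qed.

Lemma computable_weaken n (G : n.-tuple nat -> nat) :
  computable G -> computable (fun w : n.+1.-tuple nat => G [tuple of behead w]).
Proof.
move=> cG.
have := @computable_comp n n.+1 G (fun i w => tnth w (lift ord0 i)) cG
  (fun i => computable_proj _).
apply: computable_ext => w /=; congr G.
by apply: eq_from_tnth => i; rewrite tnth_mktuple tnth_behead; congr tnth; apply: val_inj; rewrite /= inordK // ltnS.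
Qed.

Lemma computable_subst n (G : n.+1.-tuple nat -> nat) (b : n.-tuple nat -> nat) :
  computable G -> computable b ->
  computable (fun v : n.-tuple nat => G [tuple of b v :: v]).
Proof.
move=> cG cb.
have := @computable_comp n.+1 n G
  (fun i => if unlift ord0 i is Some j then fun v => tnth v j else b) cG.
case/(_ _)=> [i|e He].
  by case: (unlift ord0 i) => [j|//]; apply: computable_proj.
exists e => v; have := He v; congr (computes _ _ (G _)).
apply: eq_from_tnth => i; rewrite tnth_mktuple.
by case: unliftP => [j|] -> //=; rewrite (tnth_nth 0) /= (tnth_nth 0).
Qed.

Lemma computable_S n (a : n.-tuple nat -> nat) :
  computable a -> computable (fun v => (a v).+1).
Proof.
move=> ca; have cS : computable (fun v : 1.-tuple nat => (tnth v ord0).+1).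
  by exists RSucc.
apply: computable_ext (computable_comp cS (fun=> ca)) => v /=.
by rewrite tnth_mktuple.
Qed.

Lemma computable_const n (c : nat) : computable (fun _ : n.-tuple nat => c).
Proof.
by elim: c => [|c IH]; [exists (RZero n) | apply: computable_S].
Qed.

(** The form in which [RRec] is used throughout: the number of rounds [b] is itself computed from
    the parameters, and [h] receives the index, the previous value and the parameters. *)
Lemma computable_natrec n (b a : n.-tuple nat -> nat)
    (h : nat -> nat -> n.-tuple nat -> nat) :
  computable b -> computable a ->
  computable (fun w : n.+2.-tuple nat => h (thead w) (thead [tuple of behead w])
    [tuple of behead (behead w)]) ->
  computable (fun v => nat_rect (fun=> nat) (a v) (fun i s => h i s v) (b v)).
Proof.
move=> cb [ea Ha] [eh Hh].
pose G (w : n.+1.-tuple nat) := nat_rect (fun=> nat) (a [tuple of behead w])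
  (fun i s => h i s [tuple of behead w]) (thead w).
have cG : computable G.
  exists (RRec ea eh) => w /=.
  exists (nat_rect (fun=> nat) (a [tuple of behead w])
     (fun i s => h i s [tuple of behead w])); split=> // i _.
  set s := nat_rect _ _ _ i.
  have /= := Hh [tuple of i :: s :: behead w].
  congr (computes _ _ _); rewrite /thead !(tnth_nth 0) /=; congr h.
  exact: val_inj.
apply: computable_ext (computable_subst cG cb) => v; rewrite /G theadE /=.
by congr nat_rect; [congr a; exact: val_inj | congr (fun g => fun i s => h i s g); exact: val_inj].
Qed.

Lemma computable_snd n :
  computable (fun w : n.+2.-tuple nat => thead [tuple of behead w]).
Proof.
apply: computable_ext (computable_proj (lift ord0 ord0)) => w.
by rewrite /thead tnth_behead; congr tnth; apply: val_inj; rewrite /= inordK.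
Qed.

Lemma computable_fst n : computable (fun w : n.+1.-tuple nat => thead w).
Proof. exact: computable_proj. Qed.

Lemma computable_weaken2 n (G : n.-tuple nat -> nat) :
  computable G -> computable (fun w : n.+2.-tuple nat => G [tuple of behead (behead w)]).
Proof.
move=> /computable_weaken/computable_weaken; apply: computable_ext => w.
by congr G; apply: val_inj.
Qed.

Lemma computable_add n (a b : n.-tuple nat -> nat) :
  computable a -> computable b -> computable (fun v => a v + b v).
Proof.
move=> ca cb; have := computable_natrec (h := fun i s v => s.+1) cb ca
  (computable_S (computable_snd n)).
by apply: computable_ext => v; elim: (b v) => [|m /= ->]; rewrite ?addn0 ?addnS.
Qed.

Lemma computable_mul n (a b : n.-tuple nat -> nat) :
  computable a -> computable b -> computable (fun v => a v * b v).
Proof.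
move=> ca cb; have := computable_natrec (h := fun i s v => s + a v) cb
  (computable_const n 0) (computable_add (computable_snd n) (computable_weaken2 ca)).
by apply: computable_ext => v; elim: (b v) => [|m /= ->]; rewrite ?muln0 ?mulnSr.
Qed.

Lemma computable_exp n (a b : n.-tuple nat -> nat) :
  computable a -> computable b -> computable (fun v => a v ^ b v).
Proof.
move=> ca cb; have := computable_natrec (h := fun i s v => s * a v) cb
  (computable_const n 1) (computable_mul (computable_snd n) (computable_weaken2 ca)).
by apply: computable_ext => v; elim: (b v) => [|m /= ->]; rewrite ?expnSr.
Qed.

Lemma computable_pred n (a : n.-tuple nat -> nat) :
  computable a -> computable (fun v => (a v).-1).
Proof.
move=> ca; have := computable_natrec (h := fun i s v => i) ca
  (computable_const n 0) (computable_fst _).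
by apply: computable_ext => v; case: (a v).
Qed.

Lemma computable_sub n (a b : n.-tuple nat -> nat) :
  computable a -> computable b -> computable (fun v => a v - b v).
Proof.
move=> ca cb; have := computable_natrec (h := fun i s v => s.-1) cb
  ca (computable_pred (computable_snd n)).
by apply: computable_ext => v; elim: (b v) => [|m /= ->]; rewrite ?subn0 ?subnS.
Qed.

Lemma computable_pos n (a : n.-tuple nat -> nat) :
  computable a -> computable (fun v => nat_of_bool (0 < a v)).
Proof.
move=> ca; have c1 := computable_const n 1.
apply: computable_ext (computable_sub c1 (computable_sub c1 ca)) => v.
by case: (a v) => [|[]].
Qed.

Lemma computable_leq n (a b : n.-tuple nat -> nat) :
  computable a -> computable b -> computable (fun v => nat_of_bool (a v <= b v)).
Proof.
move=> ca cb; apply: computable_ext (computable_sub (computable_const n 1)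
  (computable_pos (computable_sub ca cb))) => v.
by rewrite subn_gt0; case: leqP.
Qed.

Lemma computable_odd n (a : n.-tuple nat -> nat) :
  computable a -> computable (fun v => nat_of_bool (odd (a v))).
Proof.
move=> ca; have := computable_natrec (h := fun i s v => 1 - s) ca
  (computable_const n 0) (computable_sub (computable_const _ 1) (computable_snd n)).
by apply: computable_ext => v; elim: (a v) => [|m /= ->] //; case: odd.
Qed.

(** The recursion is [m.+1./2 = m./2 + odd m]. *)
Lemma computable_half n (a : n.-tuple nat -> nat) :
  computable a -> computable (fun v => (a v)./2).
Proof.
move=> ca; have := computable_natrec (h := fun i s v => s + odd i) ca
  (computable_const n 0)
  (computable_add (computable_snd n) (computable_odd (computable_fst _))).
apply: computable_ext => v; elim: (a v) => [|m IH] //.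
by rewrite -uphalfE uphalf_half addnC -IH.
Qed.

(** A step of [computable_natrec] has the accumulator as second argument. It is inserted here as a
    dummy, so that the general term of a sum or product can occur in such a step. *)
Lemma computable_skip n (F : nat -> n.-tuple nat -> nat) :
  computable (fun w : n.+1.-tuple nat => F (thead w) [tuple of behead w]) ->
  computable (fun w : n.+2.-tuple nat => F (thead w) [tuple of behead (behead w)]).
Proof.
move=> cF; have := computable_comp (n := n.+2)
   (H := fun i w => if unlift ord0 i is Some j then tnth w (lift ord0 (lift ord0 j)) else thead w) cF.
  case/(_ _)=> [i|e He].
    by case: (unlift ord0 i) => [j|]; apply: computable_proj.
  exists e => w; have := He w; congr (computes _ _ (F _ _)).
    by rewrite /thead tnth_mktuple unlift_none.
  apply: eq_from_tnth => i; rewrite tnth_behead tnth_mktuple.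
  have -> : inord i.+1 = lift ord0 i by apply: val_inj; rewrite /= inordK // ltnS.
  by rewrite liftK !(tnth_nth 0) /= !nth_behead.
Qed.

Lemma computable_sum n (b : n.-tuple nat -> nat) (F : nat -> n.-tuple nat -> nat) :
  computable b ->
  computable (fun w : n.+1.-tuple nat => F (thead w) [tuple of behead w]) ->
  computable (fun v => \sum_(i < b v) F i v).
Proof.
move=> cb cF.
have cF2 := computable_skip cF.
have := computable_natrec (h := fun i s v => s + F i v) cb (computable_const n 0)
  (computable_add (computable_snd n) cF2).
by apply: computable_ext => v; elim: (b v) => [|m /= ->]; rewrite ?big_ord0 ?big_ord_recr.
Qed.

Lemma computable_prod n (b : n.-tuple nat -> nat) (F : nat -> n.-tuple nat -> nat) :
  computable b ->
  computable (fun w : n.+1.-tuple nat => F (thead w) [tuple of behead w]) ->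
  computable (fun v => \prod_(i < b v) F i v).
Proof.
move=> cb cF.
have cF2 := computable_skip cF.
have := computable_natrec (h := fun i s v => s * F i v) cb (computable_const n 1)
  (computable_mul (computable_snd n) cF2).
by apply: computable_ext => v; elim: (b v) => [|m /= ->]; rewrite ?big_ord0 ?big_ord_recr.
Qed.

End Computable.

(** * Integer-valued computable functions *)

Section ComputableInt.

(** Programs output natural numbers, so an integer is carried as a difference of two of them; ring
    operations then need no case distinction on signs. *)
Definition computableZ n (Z : n.-tuple nat -> int) : Prop :=
  exists p q : n.-tuple nat -> nat,
    [/\ computable p, computable q & forall v, Z v = (p v)%:Z - (q v)%:Z].

Lemma computableZ_ext n (Z Z' : n.-tuple nat -> int) :
  Z =1 Z' -> computableZ Z -> computableZ Z'.
Proof. by move=> eZ [p [q [cp cq E]]]; exists p, q; split=> // v; rewrite -eZ. Qed.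

Lemma computableZ_nat n (a : n.-tuple nat -> nat) :
  computable a -> computableZ (fun v => (a v)%:Z).
Proof.
move=> ca; exists a, (fun=> 0%N); split=> // [|v]; last by rewrite subr0.
exact: computable_const.
Qed.

Lemma computableZ_sub n (Z Z' : n.-tuple nat -> int) :
  computableZ Z -> computableZ Z' -> computableZ (fun v => Z v - Z' v).
Proof.
move=> [p [q [cp cq E]]] [p' [q' [cp' cq' E']]].
exists (fun v => p v + q' v)%N, (fun v => q v + p' v)%N; split=> [||v].
- exact: computable_add.
- exact: computable_add.
- by rewrite E E'; lia.
Qed.

Lemma computableZ_mul n (Z Z' : n.-tuple nat -> int) :
  computableZ Z -> computableZ Z' -> computableZ (fun v => Z v * Z' v).
Proof.
move=> [p [q [cp cq E]]] [p' [q' [cp' cq' E']]].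
exists (fun v => p v * p' v + q v * q' v)%N, (fun v => p v * q' v + q v * p' v)%N.
split=> [||v]; try by apply: computable_add; apply: computable_mul.
by rewrite E E' !PoszD !PoszM; ring.
Qed.

Lemma computable_abs n (Z : n.-tuple nat -> int) :
  computableZ Z -> computable (fun v => `|Z v|%N).
Proof.
move=> [p [q [cp cq E]]].
apply: computable_ext (computable_add (computable_sub cp cq) (computable_sub cq cp)).
by move=> v; rewrite E; lia.
Qed.

Lemma computable_neg n (Z : n.-tuple nat -> int) :
  computableZ Z -> computable (fun v => nat_of_bool (Z v < 0)).
Proof.
move=> [p [q [cp cq E]]].
apply: computable_ext (computable_leq (computable_S cp) cq).
by move=> v; rewrite E; congr nat_of_bool; lia.
Qed.

Lemma computableZ_eq n (Z Z' : n.-tuple nat -> int) :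
  computableZ Z -> computableZ Z' -> computable (fun v => nat_of_bool (Z v == Z' v)).
Proof.
move=> cZ cZ'; apply: computable_ext (computable_leq
  (computable_abs (computableZ_sub cZ cZ')) (computable_const n 0)) => v.
by congr nat_of_bool; lia.
Qed.

Lemma computable_uncurry n (p : n.+1.-tuple nat -> nat) :
  computable p ->
  computable (fun w : n.+1.-tuple nat => p [tuple of thead w :: [tuple of behead w]]).
Proof.
by apply: computable_ext => w; congr p; rewrite [LHS]tuple_eta; apply: val_inj.
Qed.

Lemma computableZ_sum n (b : n.-tuple nat -> nat) (Z : nat -> n.-tuple nat -> int) :
  computable b ->
  computableZ (fun w : n.+1.-tuple nat => Z (thead w) [tuple of behead w]) ->
  computableZ (fun v => \sum_(i < b v) Z i v).
Proof.
move=> cb [p [q [cp cq E]]].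
exists (fun v => \sum_(i < b v) p [tuple of (i : nat) :: v])%N.
exists (fun v => \sum_(i < b v) q [tuple of (i : nat) :: v])%N; split=> [||v].
- exact: (computable_sum (F := fun i v => p [tuple of i :: v]) cb (computable_uncurry cp)).
- exact: (computable_sum (F := fun i v => q [tuple of i :: v]) cb (computable_uncurry cq)).
rewrite !(big_morph Posz PoszD (erefl _)) -sumrB; apply: eq_bigr => i _.
have := E [tuple of (i : nat) :: v]; rewrite theadE => <-; congr Z.
exact: val_inj.
Qed.

Lemma computableZ_sign n (a : n.-tuple nat -> nat) :
  computable a -> computableZ (fun v => (-1) ^+ a v).
Proof.
move=> ca; exists (fun v => 1 - odd (a v))%N, (fun v => nat_of_bool (odd (a v))).
split=> [||v]; [|exact: computable_odd|].
  by apply: computable_sub (computable_const n 1) (computable_odd ca).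
by rewrite -signr_odd; case: odd.
Qed.

(** A long product of differences has no convenient expansion. Sign and absolute value are computed
    apart, the sign from the number of negative factors. *)
Lemma computableZ_prod n (b : n.-tuple nat -> nat) (Z : nat -> n.-tuple nat -> int) :
  computable b ->
  computableZ (fun w : n.+1.-tuple nat => Z (thead w) [tuple of behead w]) ->
  computableZ (fun v => \prod_(i < b v) Z i v).
Proof.
move=> cb cZ.
have c1 := computable_sum (F := fun i v => nat_of_bool (Z i v < 0)) cb (computable_neg cZ).
have c2 := computable_prod (F := fun i v => `|Z i v|%N) cb (computable_abs cZ).
apply: computableZ_ext (computableZ_mul (computableZ_sign c1) (computableZ_nat c2)) => v.
elim: (b v) => [|m IH]; first by rewrite !big_ord0.
by rewrite !big_ord_recr /= -IH exprD PoszM mulrACA -intEsign.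
Qed.

(** * Decoding of sequences and evaluation of coded polynomials *)

Local Open Scope nat_scope.

Definition shr i c := nat_rect (fun=> nat) c (fun _ s => s./2) i.

Lemma shrE i c : shr i c = c %/ 2 ^ i.
Proof. by elim: i => [|i /= ->]; rewrite ?divn1 // expnSr divnMA divn2. Qed.

Arguments shr : simpl never.

Lemma computable_shr n (i c : n.-tuple nat -> nat) :
  computable i -> computable c -> computable (fun v => shr (i v) (c v)).
Proof.
move=> ci cc; exact: (computable_natrec (h := fun _ s _ => s./2) ci cc
  (computable_half (computable_snd n))).
Qed.

Lemma computable_logn2 n (c : n.-tuple nat -> nat) :
  computable c -> computable (fun v => logn 2 (c v)).
Proof.
move=> cc.
(* The valuation counts the exponents [e >= 1] for which [2 ^ e] divides [c v]; divisibility is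
   tested by whether rounding down to a multiple of [2 ^ e] loses nothing. *)
have E v : \sum_(i < (c v).-1) (c v <= 2 ^ i.+1 * shr i.+1 (c v)) = logn 2 (c v).
  have [->|c0] := posnP (c v); first by rewrite big_ord0.
  rewrite logn_count_dvd // -[X in index_iota _ X](prednK c0) big_add1 big_mkord.
  apply: eq_bigr => i _; rewrite shrE mulnC; congr nat_of_bool.
  by rewrite dvdn_eq eqn_leq leq_trunc_div.
apply: computable_ext E _.
apply: (computable_sum (F := fun i v => nat_of_bool (c v <= 2 ^ i.+1 * shr i.+1 (c v)))).
  exact: computable_pred.
have c1 := computable_S (computable_fst n).
have c2 := computable_weaken cc.
exact: computable_leq c2 (computable_mul (computable_exp (computable_const _ 2) c1)
  (computable_shr c1 c2)).
Qed.

(** The code of [x :: s] is [2 ^ x] times the odd number [2 * code s + 1]. The 2-adic valuation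
    therefore reads the head, and a shift by one more than it leaves the code of the tail. Past the
    end the code is 0 and the entry read is 0. *)
Definition code_nth i c :=
  logn 2 (nat_rect (fun=> nat) c (fun _ s => shr (logn 2 s).+1 s) i).

Lemma computable_code_nth n (i c : n.-tuple nat -> nat) :
  computable i -> computable c -> computable (fun v => code_nth (i v) (c v)).
Proof.
move=> ci cc; apply: computable_logn2.
apply: (computable_natrec (h := fun _ s _ => shr (logn 2 s).+1 s) ci cc).
exact: computable_shr (computable_S (computable_logn2 (computable_snd n))) (computable_snd n).
Qed.

Lemma code_nthE i s : code_nth i (CodeSeq.code s) = nth 0 s i.
Proof.
have E : nat_rect (fun=> nat) (CodeSeq.code s) (fun _ s => shr (logn 2 s).+1 s) i
       = CodeSeq.code (drop i s).
  elim: i => [|i /= ->]; first by rewrite drop0.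
  rewrite (_ : drop i.+1 s = drop 1 (drop i s)); last by rewrite drop_drop.
  case: (drop i s) => [|x t] //=; rewrite ?drop0.
  rewrite shrE lognM ?expn_gt0 // lognX logn_prime //= muln1.
  rewrite [X in (_ + X)](_ : _ = 0); last by rewrite lognE /= dvdn2 /= odd_double.
  by rewrite addn0 expnSr divnMA mulKn ?expn_gt0 // divn2 /= uphalf_double.
rewrite /code_nth E.
rewrite -[in RHS](cat_take_drop i s) nth_cat size_take.
case: (ltnP i (size s)) => [lti|gei]; last by rewrite drop_oversize // take_oversize // ltnNge gei /= nth_nil.
rewrite ltnn subnn; case: (drop i s) => [|x t] //=.
rewrite lognM ?expn_gt0 // lognX logn_prime //= muln1.
by rewrite [X in (_ + X)](_ : _ = 0) ?addn0 //; rewrite lognE /= dvdn2 /= odd_double.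
Qed.

Lemma code_size s : size s <= CodeSeq.code s.
Proof.
elim: s => //= x s IH; apply: leq_ltn_trans IH _.
have : 0 < 2 ^ x by rewrite expn_gt0.
by nia.
Qed.

Lemma code_mem s x : x \in s -> x <= CodeSeq.code s.
Proof.
elim: s => //= y s IH; rewrite inE => /orP [/eqP->|/IH].
  apply: leq_trans (ltnW (ltn_expl y (isT : 1 < 2))) _.
  by rewrite leq_pmulr.
have : 0 < 2 ^ y by rewrite expn_gt0.
by nia.
Qed.

Local Close Scope nat_scope.

Lemma PoszX (m n : nat) : (m ^ n)%N%:Z = m%:Z ^+ n.
Proof. by rewrite -!natz natrX. Qed.

Definition decode_int (d : nat) : int := if odd d then Negz d./2 else Posz d./2.

Lemma code_intK z : decode_int (code_int z) = z.
Proof. by case: z => m; rewrite /decode_int /= ?odd_double /= ?uphalf_double ?doubleK. Qed.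

Lemma computable_decode n (d : n.-tuple nat -> nat) :
  computable d -> computableZ (fun v => decode_int (d v)).
Proof.
move=> cd.
exists (fun v => (1 - odd (d v)) * (d v)./2)%N, (fun v => odd (d v) * (d v)./2.+1)%N.
split=> [||v].
- apply: computable_mul (computable_sub (computable_const n 1) (computable_odd cd)) _.
  exact: computable_half.
- exact: computable_mul (computable_odd cd) (computable_S (computable_half cd)).
- by rewrite /decode_int; case: odd; lia.
Qed.

(** The code itself bounds the number of coefficients by [code_size]; the surplus terms decode to
    0. *)
Definition eval_code (c k : nat) : int :=
  \sum_(i < c) decode_int (code_nth i c) * (k ^ i)%N%:Z.

Lemma eval_codeE (f : {poly int}) k : eval_code (code_poly f) k = f.[k%:Z].
Proof.
rewrite /eval_code horner_coef /code_poly.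
set s := [seq code_int c | c <- f].
have sz : size s = size f by rewrite size_map.
have := code_size s; rewrite sz => le.
rewrite (big_ord_widen _ (fun i : nat => f`_i * (k%:Z) ^+ i) le) [RHS]big_mkcond /=.
apply: eq_bigr => i _; rewrite code_nthE.
case: ltnP => h; first by rewrite (nth_map 0) // code_intK PoszX.
by rewrite nth_default ?sz // mul0r.
Qed.

Lemma computable_eval n (c k : n.-tuple nat -> nat) :
  computable c -> computable k -> computableZ (fun v => eval_code (c v) (k v)).
Proof.
move=> cc ck.
apply: (computableZ_sum
  (Z := fun i v => decode_int (code_nth i (c v)) * (k v ^ i)%N%:Z) cc).
have c1 := computable_weaken cc; have c2 := computable_weaken ck.
apply: computableZ_mul.
  exact: computable_decode (computable_code_nth (computable_fst _) c1).
exact: computableZ_nat (computable_exp c2 (computable_fst _)).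
Qed.

End ComputableInt.

(** * Sums over primes *)

Lemma prime_dvd_fact p m : prime p -> (p %| m`!)%N -> (p <= m)%N.
Proof.
move=> pp; elim: m => [|m IH]; first by rewrite dvdn1 => /eqP p1; rewrite p1 in pp.
by rewrite factS Euclid_dvdM // => /orP [/dvdn_leq -> //|/IH]; apply: leqW.
Qed.

Section PrimeSums.
Variable R : realType.
Implicit Types n m p X : nat.

Lemma ln_nat_ge0 n : 0 <= ln (n%:R : R).
Proof.
case: n => [|n]; first by rewrite ln0.
by apply: ln_ge0; rewrite ler1n.
Qed.

Lemma ler_ln_nat m n : (0 < m)%N -> (m <= n)%N -> ln (m%:R : R) <= ln n%:R.
Proof.
by move=> m0 le; rewrite ler_ln ?posrE ?ltr0n ?ler_nat //; apply: leq_trans le.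
Qed.

Lemma ln_nat_le n : ln (n.+1%:R : R) <= n%:R.
Proof.
have h : -1 < n%:R :> R by apply: lt_le_trans (ler0n R n); rewrite ltrN10.
by have := le_ln1Dx h; rewrite -natr1 addrC.
Qed.

Lemma ln_nat_prod (I : Type) (r : seq I) (P : pred I) (F : I -> nat) :
  (forall i, P i -> (0 < F i)%N) ->
  ln ((\prod_(i <- r | P i) F i)%N%:R : R) = \sum_(i <- r | P i) ln (F i)%:R.
Proof.
move=> F0; suff [] : (0 < (\prod_(i <- r | P i) F i))%N /\
  ln ((\prod_(i <- r | P i) F i)%N%:R : R) = \sum_(i <- r | P i) ln (F i)%:R by [].
elim: r => [|x r [IH1 IH2]]; first by rewrite !big_nil ln1.
rewrite !big_cons; case: ifP => // Px; split; first by rewrite muln_gt0 F0.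
by rewrite natrM lnM ?posrE ?ltr0n ?F0 // IH2.
Qed.

Lemma ln_logn n X : (0 < n)%N -> (forall p, prime p -> (p %| n)%N -> (p <= X)%N) ->
  ln (n%:R : R) = \sum_(p < X.+1 | prime p) (logn p n)%:R * ln p%:R.
Proof.
move=> n0 nX.
pose Y := maxn n X.
have E : n = (\prod_(p < Y.+1 | prime p) p ^ logn p n)%N.
  rewrite -{1}(partnT n0) (@widen_partn Y) ?leq_maxl // big_mkord [RHS]big_mkcond.
  apply: eq_bigr => p _ /=.
  by case: ifP => // /negbT np; rewrite lognE (negbTE np).
rewrite {1}E ln_nat_prod => [|p pp]; last by rewrite expn_gt0 prime_gt0.
rewrite (big_ord_widen_cond Y.+1 prime (fun p => (logn p n)%:R * ln p%:R)); last first.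
  by rewrite ltnS leq_maxr.
rewrite [RHS]big_mkcondr /=; apply: eq_bigr => p pp.
rewrite natrX lnXn ?ltr0n ?prime_gt0 // -[LHS]mulr_natl.
case: ifP => //; rewrite ltnS => /negbT pX.
have [/(nX _ pp) h|h] := boolP (p %| n)%N; first by rewrite h in pX.
by rewrite lognE (negbTE h) !andbF mul0r.
Qed.

(** Lower bounds for the valuations at some primes suffice, because all other terms of [ln_logn] are
    nonnegative. *)
Lemma sum_logn_le n X (Q : pred nat) (e : nat -> R) :
  (0 < n)%N -> (forall p, Q p -> prime p /\ e p <= (logn p n)%:R) ->
  \sum_(p < X.+1 | Q p) e p * ln p%:R <= ln (n%:R : R).
Proof.
move=> n0 Qe; rewrite (@ln_logn n (maxn X n)) //; last first.
  by move=> p _ /dvdn_leq -/(_ n0) h; rewrite leq_max h orbT.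
rewrite (big_ord_widen_cond (maxn X n).+1 Q (fun p => e p * ln p%:R)); last first.
  by rewrite ltnS leq_maxl.
rewrite big_mkcond [leRHS]big_mkcond; apply: ler_sum => p _.
case: ifP => [/andP [/Qe [-> le] _]|_].
  by rewrite ler_wpM2r ?ln_nat_ge0.
by case: ifP => // _; rewrite mulr_ge0 ?ln_nat_ge0.
Qed.

Definition theta n : R := \sum_(p < n.+1 | prime p) ln p%:R.

(** Chebyshev's argument: every prime in [(m, 2m]] divides the central binomial coefficient, which
    is at most [2 ^ (2m)], and [ln 2 <= 1]. *)
Lemma theta_double m : theta m.*2 <= theta m + (m.*2)%:R.
Proof.
rewrite /theta.
have le : (m.+1 <= m.*2.+1)%N by rewrite ltnS -addnn leq_addr.
rewrite (big_ord_widen_cond _ prime (fun p => ln p%:R) le).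
rewrite (bigID (fun p : 'I__ => (p < m.+1)%N)) /= lerD2l.
pose Q p := [&& prime p, (m < p)%N & (p <= m.*2)%N].
have b0 : (0 < 'C(m.*2, m))%N by rewrite bin_gt0 -addnn leq_addr.
have := @sum_logn_le 'C(m.*2, m) m.*2 Q (fun=> 1) b0.
have -> : \sum_(p < m.*2.+1 | Q p) 1 * ln (p%:R : R)
   = \sum_(i < m.*2.+1 | prime i && ~~ (i < m.+1)%N) ln i%:R.
  apply: eq_big => [p|p _]; last by rewrite mul1r.
  by rewrite /Q -leqNgt -(ltnS p) ltn_ord andbT.
move=> h; apply: le_trans (h _) _ => [p /and3P [pp mp pm]|].
  split=> //; rewrite ler1n -pfactor_dvdn // expn1.
  have := bin_fact (leq_addr m m); rewrite addnK addnn => E.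
  have : (p %| m.*2`!)%N by rewrite dvdn_fact // prime_gt0.
  rewrite -E !Euclid_dvdM // => /orP [//|].
  suff -> : (p %| m`!)%N = false by [].
  by apply/negP; move=> /(prime_dvd_fact pp); rewrite leqNgt mp.
apply: le_trans (_ : ln ((2 ^ m.*2)%N%:R : R) <= _).
  apply: ler_ln_nat => //.
  have := expnDn 1 1 m.*2; rewrite addn1 => ->.
  have hm : (m < m.*2.+1)%N by rewrite ltnS -addnn leq_addr.
  by rewrite (bigD1 (Ordinal hm)) //= !exp1n !muln1 leq_addr.
rewrite natrX lnXn ?ltr0n // -[leRHS]mulr_natl mulr1 -[leLHS]mulr_natl.
by rewrite ler_piMr // (ln_nat_le 1).
Qed.
End PrimeSums.

(** * Explicit Chebyshev bounds *)

Section ChebyshevBounds.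
Variable R : realType.
Implicit Types n m p X : nat.

(** Strong induction with [theta_double] at [uphalf n]: the bound obtained is
    [6 * uphalf n <= 3 * (n + 1)], which is at most [4 * n] once [n >= 3]. *)
Lemma theta_le n : theta R n <= 4 * n%:R.
Proof.
have homo m : theta R m <= theta R m.+1.
  rewrite /theta [leRHS]big_mkcond big_ord_recr -big_mkcond /= lerDl.
  by case: ifP => // _; apply: ln_nat_ge0.
elim/ltn_ind: n => n IH; have [n3|n3] := ltnP n 3.
  suff : theta R n <= n%:R by have := ler0n R n; lra.
  have ln2 : ln (2 : R) <= 1 by apply: (ln_nat_le R 1).
  rewrite /theta big_mkcond.
  by case: n {IH} n3 => [|[|[|]]] // _; rewrite !big_ord_recr big_ord0 /= ?addr0 ?add0r ?ler0n //; lra.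
have E : n = (n./2.*2 + odd n)%N by rewrite addnC odd_double_half.
have ltm : (uphalf n < n)%N by rewrite uphalf_half; lia.
have le2 : (n <= (uphalf n).*2)%N by rewrite uphalf_half; lia.
have le3 : ((uphalf n).*2 <= n.+1)%N by rewrite uphalf_half; lia.
have : theta R n <= theta R (uphalf n).*2.
  by rewrite -(subnK le2); elim: (_ - n)%N => //= k IHk; apply: le_trans IHk (homo _).
move/le_trans; apply; apply: le_trans (theta_double _ _) _.
apply: le_trans (_ : 4 * (uphalf n)%:R + (uphalf n).*2%:R <= _).
  by rewrite lerD2r; apply: IH.
rewrite -muln2 natrM.
have : (uphalf n).*2%:R <= n.+1%:R :> R by rewrite ler_nat.
have : 3 <= n%:R :> R by rewrite (ler_nat R 3).
by rewrite -muln2 natrM -natr1; lra.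
Qed.

Lemma sqrt_floor n : exists s, (s ^ 2 <= n < s.+1 ^ 2)%N.
Proof.
elim: n => [|n [s /andP [le lt]]]; first by exists 0%N.
have [lt'|ge'] := ltnP n.+1 (s.+1 ^ 2); first by exists s; rewrite lt' (leqW le).
exists s.+1; rewrite ge' /=; apply: leq_ltn_trans lt _.
by rewrite ltn_exp2r.
Qed.

(** With [s] the integer square root of [X], a prime [p > s] satisfies [ln X <= 2 * ln p], so these
    contribute at most [2 * theta X <= 8 * X]. There are at most [s] others, each contributing
    [ln X <= 2 * s], hence at most [2 * X] in all. *)
Lemma primes_ln_le X : \sum_(p < X.+1 | prime p) ln (X%:R : R) <= 10 * X%:R.
Proof.
have [s /andP [le lt]] := sqrt_floor X.
have [->|X0] := posnP X; first by rewrite ln0 // big1 // mulr0.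
have lnX : ln (X%:R : R) <= 2 * ln s.+1%:R.
  apply: le_trans (ler_ln_nat R X0 (ltnW lt)) _.
  by rewrite natrX lnXn ?ltr0n // mulr_natl.
apply: le_trans (_ : \sum_(p < X.+1 | prime p)
   ((if (p <= s)%N then ln (X%:R : R) else 0) + 2 * ln p%:R) <= _).
  apply: ler_sum => p pp; case: leqP => ps.
    by rewrite lerDl mulr_ge0 // ln_nat_ge0.
  by rewrite add0r; apply: le_trans lnX _; rewrite ler_pM2l // ler_ln_nat.
rewrite big_split /= -mulr_sumr -/(theta R X).
have := theta_le X.
suff : \sum_(p < X.+1 | prime p) (if (p <= s)%N then ln X%:R else 0) <= 2 * X%:R :> R by lra.
apply: le_trans (_ : \sum_(p < X.+1 | (0 < p)%N && (p <= s)%N) ln X%:R <= _).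
  rewrite -big_mkcondr big_mkcond [leRHS]big_mkcond; apply: ler_sum => p _.
  case: ifP => [/andP [pp ->]|_]; first by rewrite prime_gt0.
  by case: ifP => // _; apply: ln_nat_ge0.
have le' : (s.+1 <= X.+1)%N by rewrite ltnS; apply: leq_trans le; rewrite expnS; nia.
have -> : \sum_(p < X.+1 | (0 < p)%N && (p <= s)%N) ln X%:R
   = \sum_(p < s.+1 | (0 < p)%N) ln X%:R :> R.
  by rewrite (big_ord_widen_cond _ (fun p => 0 < p)%N (fun=> ln X%:R) le').
rewrite big_mkcond big_ord_recl /= add0r sumr_const card_ord.
rewrite -[leLHS]mulr_natl.
have : s%:R ^+ 2 <= X%:R :> R by rewrite -natrX ler_nat.
have h1 := ln_nat_le R s; have s0 := ler0n R s.
have h2 : ln X%:R <= 2 * s%:R :> R by lra.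
have := ler_wpM2l s0 h2; rewrite expr2; lra.
Qed.

(** The right-hand side is chosen so that its increments dominate the new terms, by
    [ln (n + 1) <= ln n + 1 / n]; at [n = 1] both sides vanish. *)
Lemma ln_div_le n : (0 < n)%N ->
  \sum_(p < n.+1 | (1 < p)%N) ln (p%:R : R) / (p%:R * p.-1%:R) <= 2 - (ln n%:R + 2) / n%:R.
Proof.
elim: n => // n IH _; rewrite big_mkcond big_ord_recr -big_mkcond /=.
have [->|n0] := posnP n.
  by rewrite big_mkcond !big_ord_recr big_ord0 /= ln1 !addr0 add0r divr1 subrr.
rewrite ltnS n0 -lerBrDr; apply: le_trans (IH n0) _.
have x0 : 0 < n%:R :> R by rewrite ltr0n.
have x1 : 1 <= n%:R :> R by rewrite ler1n.
have h : ln (n.+1%:R : R) <= ln n%:R + n%:R^-1.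
  have -> : n.+1%:R = n%:R * (1 + n%:R^-1) :> R.
    by rewrite mulrDr mulfV ?gt_eqF // mulr1 natr1.
  have i0 : 0 < n%:R^-1 :> R by rewrite invr_gt0.
  rewrite lnM ?posrE ?addr_gt0 // lerD2l le_ln1Dx //.
  by apply: lt_trans i0; rewrite ltrN10.
have L0 := ln_nat_ge0 R n.
move: h L0; rewrite -natr1.
set x := n%:R; set L := ln x; set L' := ln (x + 1) => h L0.
rewrite -subr_ge0.
have -> : 2 - (L' + 2) / (x + 1) - L' / ((x + 1) * x) - (2 - (L + 2) / x)
  = ((x + 1) * (L + x^-1 - L') + (1 - x^-1)) / ((x + 1) * x).
  by field; rewrite ?gt_eqF // ?addr_gt0.
apply: divr_ge0; last by rewrite mulr_ge0 //; lra.
have : x^-1 <= 1 by rewrite invf_le1.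
nra.
Qed.
End ChebyshevBounds.

(** * Norm forms on a box and collisions modulo a prime *)

Section Box.
Local Open Scope nat_scope.

(** Cauchy-Schwarz for the sizes [n c] of the fibres of [phi]. *)
Lemma card_sq_le_collisions (T : finType) (p : nat) (phi : T -> 'I_p) :
  #|T| ^ 2 <= p * \sum_(v : T) \sum_(w : T) (phi v == phi w).
Proof.
pose n c := \sum_(v : T) (phi v == c).
have En : \sum_c n c = #|T|.
  rewrite exchange_big /= -sum1_card; apply: eq_bigr => v _.
  rewrite (bigD1 (phi v)) //= eqxx big1 ?addn0 // => c.
  by rewrite eq_sym => /negbTE ->.
have E2 : \sum_(v : T) \sum_(w : T) (phi v == phi w) = \sum_c n c ^ 2.
  transitivity (\sum_c \sum_v \sum_w ((phi v == c) * (phi w == c))).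
    rewrite [RHS]exchange_big /=; apply: eq_bigr => v _.
    rewrite [RHS]exchange_big /=; apply: eq_bigr => w _.
    rewrite (bigD1 (phi v)) //= eqxx mul1n eq_sym big1 ?addn0 // => c.
    by rewrite eq_sym => /negbTE ->.
  apply: eq_bigr => c _; rewrite expnS expn1 /n big_distrl /=.
  by apply: eq_bigr => v _; rewrite big_distrr.
rewrite E2 -(leq_pmul2l (isT : 0 < 2)) -En.
have -> : 2 * (\sum_c n c) ^ 2 = \sum_c \sum_d 2 * (n c * n d).
  rewrite expnS expn1 big_distrl /= big_distrr /=; apply: eq_bigr => c _.
  by rewrite big_distrr big_distrr.
have -> : 2 * (p * \sum_c n c ^ 2) = \sum_c \sum_d (n c ^ 2 + n d ^ 2).
  under [RHS]eq_bigr => c _ do rewrite big_split /= sum_nat_const card_ord.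
  rewrite big_split /= sum_nat_const card_ord -big_distrr /=; lia.
by apply: leq_sum => c _; apply: leq_sum => d _; apply: nat_Cauchy.
Qed.

(** The absolute norm of [a + b * sqrt D]. *)
Definition nform (D : int) (a b : int) : nat := `|(a ^+ 2 - D * b ^+ 2)%R|.

(** Modulo [p] the norm is [(a + s * b) * (a - s * b)]. If [p] divides both factors it divides
    [2 * a] and [2 * s * b], hence [a] and [b] as it divides neither 2 nor [D], and then [p ^ 2]
    divides the norm. *)
Lemma logn_nform (D s a b : int) (p : nat) :
  prime p -> ~~ (p %| 2 * `|D|) -> (p %| (s ^+ 2 - D)%R)%Z ->
  0 < nform D a b ->
  (p %| (a + s * b)%R)%Z + (p %| (a - s * b)%R)%Z <= logn p (nform D a b).
Proof.
move=> pp pD ps N0.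
have pprod : (p %| ((a ^+ 2 - D * b ^+ 2) - (a + s * b) * (a - s * b))%R)%Z.
  have -> : ((a ^+ 2 - D * b ^+ 2) - (a + s * b) * (a - s * b) = (s ^+ 2 - D) * b ^+ 2)%R by ring.
  exact: dvdz_mulr.
have p1 : (p %| (a + s * b)%R)%Z || (p %| (a - s * b)%R)%Z -> 0 < logn p (nform D a b).
  move=> h; rewrite -pfactor_dvdn // expn1.
  have {h} : (p %| ((a + s * b) * (a - s * b))%R)%Z by case/orP: h => h; [apply: dvdz_mulr|apply: dvdz_mull].
  by move=> /(rpredD pprod); rewrite subrK.
have [h1|h1] := boolP (p %| (a + s * b)%R)%Z; have [h2|h2] := boolP (p %| (a - s * b)%R)%Z => //=.
- rewrite add1n -pfactor_dvdn //.
  have E2 : (p %| (2 * a)%R)%Z.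
    by have := rpredD h1 h2; congr dvdz; ring.
  have E3 : (p %| (2 * (s * b))%R)%Z.
    by have := rpredB h1 h2; congr dvdz; ring.
  have np2 : (p %| 2) = false.
    by apply: contraNF pD => h; rewrite dvdn_mulr.
  have pa : p %| `|a|.
    by move: E2; rewrite dvdzE abszM /= Euclid_dvdM // np2.
  have pb : p %| `|b|.
    move: E3; rewrite dvdzE !abszM /= !Euclid_dvdM // np2 /= => /orP [h|//].
    case/negP: pD; rewrite Euclid_dvdM // np2 /=.
    have h' : (p %| (s ^+ 2)%R)%Z by apply: dvdz_mulr; rewrite dvdzE.
    by have := rpredB h' ps; rewrite subKr dvdzE.
  have pa' : (p %| a)%Z by rewrite dvdzE.
  have pb' : (p %| b)%Z by rewrite dvdzE.
  have : (((p : int) ^+ 2)%R %| (a ^+ 2 - D * b ^+ 2)%R)%Z.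
    by apply: rpredB; [|apply: dvdz_mull]; apply: dvdz_exp2r.
  by rewrite dvdzE abszX.
- by apply: p1; rewrite h1.
- by apply: p1; rewrite h2 orbT.
Qed.

Variables (R : realType) (D : int).
Hypothesis D_nsq : forall a b : int, (a ^+ 2 = D * b ^+ 2)%R -> a = 0%R /\ b = 0%R.

Let nd A (x : ('I_A * 'I_A) * ('I_A * 'I_A)) : nat :=
  nform D (x.1.1%:Z - x.2.1%:Z)%R (x.1.2%:Z - x.2.2%:Z)%R.

Lemma nd_gt0 A (x : ('I_A * 'I_A) * ('I_A * 'I_A)) : x.1 != x.2 -> 0 < nd x.
Proof.
apply: contraNT; rewrite lt0n negbK absz_eq0 subr_eq0 => /eqP /D_nsq [h1 h2].
by case: x h1 h2 => [[a b] [c d]] /= h1 h2; apply/eqP; congr (_, _); apply: val_inj; rewrite /=; lia.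
Qed.

Lemma nd_le A (x : ('I_A * 'I_A) * ('I_A * 'I_A)) : nd x <= (1 + `|D|) * A ^ 2.
Proof.
have H (i j : 'I_A) : `|(i%:Z - j%:Z)%R ^+ 2| <= A ^ 2.
  rewrite abszX leq_exp2r //.
  by have := ltn_ord i; have := ltn_ord j; lia.
rewrite /nd /nform mulnDl mul1n; apply: leq_trans (leqD_dist _ 0%R _) _.
rewrite subr0 sub0r abszN abszM; apply: leq_add; first exact: H.
by rewrite leq_mul2l H orbT.
Qed.

(** Each of the maps [(x, y) |-> x + s * y] and [(x, y) |-> x - s * y] modulo [p] has at least
    [A ^ 4 / p] ordered colliding pairs. The diagonal accounts for [A ^ 2] pairs per map; the
    remaining collisions are counted by [logn_nform]. *)
Lemma logn_box A p (s : int) :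
  prime p -> ~~ (p %| 2 * `|D|) -> (p %| (s ^+ 2 - D)%R)%Z ->
  2 * A ^ 4 <= p * (2 * A ^ 2 + \sum_(x : ('I_A * 'I_A) * ('I_A * 'I_A) | x.1 != x.2) logn p (nd x)).
Proof.
move=> pp pD ps.
have p0 : (0 < p%:Z)%R by have := prime_gt0 pp; lia.
have lt (s' : int) (v : 'I_A * 'I_A) : `|((v.1%:Z + s' * v.2%:Z)%R %% p)%Z| < p.
  by have := ltz_pmod (v.1%:Z + s' * v.2%:Z)%R p0; have := modz_ge0 (v.1%:Z + s' * v.2%:Z)%R (lt0r_neq0 p0); lia.
pose phi s' v := Ordinal (lt s' v).
have phiP s' v w : phi s' v == phi s' w -> (p %| ((v.1%:Z - w.1%:Z) + s' * (v.2%:Z - w.2%:Z))%R)%Z.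
  move=> /eqP /(congr1 val) /= E.
  have := modz_ge0 (v.1%:Z + s' * v.2%:Z)%R (lt0r_neq0 p0).
  have := modz_ge0 (w.1%:Z + s' * w.2%:Z)%R (lt0r_neq0 p0) => h1 h2.
  have /eqP : ((v.1%:Z + s' * v.2%:Z)%R %% p)%Z = ((w.1%:Z + s' * w.2%:Z)%R %% p)%Z by lia.
  by rewrite eqz_mod_dvd; congr dvdz; ring.
have c1 := card_sq_le_collisions (phi s).
have c2 := card_sq_le_collisions (phi (- s)%R).
have E : #|{: 'I_A * 'I_A}| ^ 2 = A ^ 4 by rewrite card_prod card_ord mulnn -expnM.
rewrite E in c1 c2.
apply: leq_trans (_ : p * (\sum_v \sum_w (phi s v == phi s w)) + p * (\sum_v \sum_w (phi (- s)%R v == phi (- s)%R w)) <= _).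
  by rewrite mul2n -addnn leq_add.
rewrite -mulnDr leq_mul2l; apply/orP; right.
rewrite !pair_big /= -big_split /= (bigID (fun x => x.1 == x.2)) /=.
apply: leq_add.
  apply: leq_trans (_ : \sum_(x : ('I_A * 'I_A) * ('I_A * 'I_A) | x.1 == x.2) 2 * 1 <= _).
    by apply: leq_sum => x _; rewrite muln1 (leq_add (leq_b1 _) (leq_b1 _)).
  rewrite -big_distrr /= leq_mul2l /=.
  have -> : \sum_(x : ('I_A * 'I_A) * ('I_A * 'I_A) | x.1 == x.2) 1 = \sum_v \sum_(w : 'I_A * 'I_A | w == v) 1.
    by rewrite pair_big_dep /=; apply: eq_bigl => x; rewrite eq_sym.
  under eq_bigr => v _ do rewrite big_pred1_eq.
  by rewrite sum_nat_const card_prod card_ord muln1 mulnn.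
apply: leq_sum => -[v w] /= vw.
apply: leq_trans (logn_nform pp pD ps (nd_gt0 (x := (v, w)) vw)).
apply: leq_add.
  by case: eqP => // /eqP /phiP ->.
by case: eqP => // /eqP /phiP; rewrite mulNr => ->.
Qed.

End Box.

Lemma logn_fact_le p n : prime p -> (p.-1 * logn p n`! <= n)%N.
Proof.
move=> pp; rewrite logn_fact // big_add1 /= big_mkord.
(* Legendre's sum is a truncated geometric series; keeping the remainder [n %/ p ^ m] lets the
   induction telescope. *)
have H m : (p.-1 * \sum_(i < m) n %/ p ^ i.+1 + n %/ p ^ m <= n)%N.
  elim: m => [|m IH]; first by rewrite big_ord0 muln0 divn1.
  apply: leq_trans IH; rewrite big_ord_recr /= mulnDr -addnA leq_add2l.
  rewrite expnSr divnMA.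
  have := leq_trunc_div (n %/ p ^ m) p; have := prime_gt0 pp.
  by case: p {pp} => // p _ /=; nia.
by apply: leq_trans (H n); apply: leq_addr.
Qed.

(** * Sums over the primes modulo which [D] is a square *)

Section SplitPrimes.
Variables (R : realType) (D : int).
Hypothesis D_nsq : forall a b : int, a ^+ 2 = D * b ^+ 2 -> a = 0 /\ b = 0.
Implicit Types n m p X N A : nat.

(** The product [Pi] of the norms of all differences in the box has logarithm at most
    [A ^ 4 * ln ((1 + |D|) * A ^ 2)], whereas [logn_box] makes it at least [2 * A ^ 4] times the
    sum, up to an error controlled by [theta]. The two collision maps produce the 2, and thus the
    decisive factor 1/2. *)
Lemma box_ln_le A X (Q : pred nat) :
  (forall p, Q p -> [/\ prime p, ~~ (p %| 2 * `|D|)%N & exists s : int, (p %| s ^+ 2 - D)%Z]) ->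
  (0 < A)%N -> (X <= A ^ 2)%N ->
  \sum_(p < X.+1 | Q p) ln (p%:R : R) / p%:R <= ln (((1 + `|D|) * A ^ 2)%N%:R) / 2 + 4.
Proof.
move=> HQ A0 XA.
pose nd (x : ('I_A * 'I_A) * ('I_A * 'I_A)) : nat :=
  nform D (x.1.1%:Z - x.2.1%:Z)%R (x.1.2%:Z - x.2.2%:Z)%R.
have nd0 x : x.1 != x.2 -> (0 < nd x)%N by apply: nd_gt0.
pose Pi := (\prod_(x | x.1 != x.2) nd x)%N.
have Pi0 : (0 < Pi)%N by apply: prodn_cond_gt0.
have lPi p : logn p Pi = (\sum_(x | x.1 != x.2) logn p (nd x))%N.
  suff [] : (0 < Pi)%N /\ logn p Pi = (\sum_(x | x.1 != x.2) logn p (nd x))%N by [].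
  rewrite /Pi; elim/big_rec2: _ => [|x a b x0 [b0 <-]]; first by rewrite logn1.
  by rewrite lognM ?muln_gt0 ?nd0.
pose a : R := A%:R.
have a0 : 0 < a by rewrite ltr0n.
have a1 : 1 <= a by rewrite ler1n.
have := @sum_logn_le R Pi X Q (fun p => 2 * a ^+ 4 / p%:R - 2 * a ^+ 2) Pi0.
have HQ' p : Q p -> prime p /\ 2 * a ^+ 4 / p%:R - 2 * a ^+ 2 <= (logn p Pi)%:R.
  move=> /HQ [pp pD [s ps]]; split=> //.
  have p0 : 0 < p%:R :> R by rewrite ltr0n prime_gt0.
  rewrite lerBlDl ler_pdivrMr // [_ * p%:R]mulrC lPi.
  have := logn_box D_nsq A pp pD ps.
  by rewrite -(ler_nat R) !(natrM, natrD, natrX).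
move=> /(_ HQ').
have -> : \sum_(p < X.+1 | Q p) (2 * a ^+ 4 / p%:R - 2 * a ^+ 2) * ln (p%:R : R)
  = 2 * a ^+ 4 * (\sum_(p < X.+1 | Q p) ln (p%:R : R) / p%:R)
    - 2 * a ^+ 2 * \sum_(p < X.+1 | Q p) ln (p%:R : R).
  rewrite !mulr_sumr -sumrB; apply: eq_bigr => p _.
  by rewrite mulrBl -[X in X - _]mulrA [_^-1 * _]mulrC.
have : \sum_(p < X.+1 | Q p) ln (p%:R : R) <= 4 * a ^+ 2.
  apply: le_trans (_ : theta R X <= _).
    rewrite /theta big_mkcond [leRHS]big_mkcond; apply: ler_sum => p _.
    case: ifP => [/HQ [-> //]|_]; case: ifP => // _; exact: ln_nat_ge0.
  apply: le_trans (theta_le _ _) _.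
  by rewrite ler_pM2l // -natrX ler_nat.
have : ln (Pi%:R : R) <= a ^+ 4 * ln (((1 + `|D|) * A ^ 2)%N%:R).
  rewrite /Pi ln_nat_prod //.
  apply: le_trans (_ : \sum_(x : ('I_A * 'I_A) * ('I_A * 'I_A)) ln (((1 + `|D|) * A ^ 2)%N%:R) <= _).
    rewrite big_mkcond; apply: ler_sum => x _; case: ifP => [/nd0 h|_].
      by apply: ler_ln_nat => //; apply: nd_le.
    exact: ln_nat_ge0.
  have cA : #|{: ('I_A * 'I_A) * ('I_A * 'I_A)}|%:R = a ^+ 4 :> R.
    by rewrite !card_prod !card_ord !natrM -/a; ring.
  by rewrite sumr_const -[leLHS]mulr_natl -cA.
set S := \sum_(p < _ | _) _ / _; set L := ln (((1 + `|D|) * A ^ 2)%N%:R).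
set T := \sum_(p < _ | _) _; set P := ln Pi%:R => hP hT h.
have a4 : 0 < a ^+ 4 by rewrite exprn_gt0.
rewrite -(ler_pM2l a4).
have := ler_wpM2l (exprn_ge0 2 (ltW a0)) hT; lra.
Qed.

(** The box has side [s.+1], with [s] the integer square root of [N], so that its area is at most
    [4 * N]. The primes dividing [2 * D] are excluded from the box argument and add at most
    [ln (2 * |D|)]. *)
Lemma split_ln_le N (Q : pred nat) : (0 < N)%N -> D != 0 ->
  (forall p, Q p -> prime p /\ exists s : int, (p %| s ^+ 2 - D)%Z) ->
  \sum_(p < N.+1 | Q p) ln (p%:R : R) / p%:R <= ln N%:R / 2 + 5 + 4 * `|D|%N%:R.
Proof.
move=> N0 D0 HQ; rewrite (bigID (fun p : 'I__ => (p %| 2 * `|D|)%N)) /=.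
have [s /andP [sle slt]] := sqrt_floor N.
have s0 : (0 < s)%N by rewrite lt0n; apply: contraTneq slt => ->; rewrite -leqNgt.
have h1 := @box_ln_le s.+1 N (fun p => Q p && ~~ (p %| 2 * `|D|)%N).
have {}h1 : \sum_(p < N.+1 | Q p && ~~ (p %| 2 * `|D|)%N) ln (p%:R : R) / p%:R
    <= ln (((1 + `|D|) * s.+1 ^ 2)%N%:R) / 2 + 4.
  by apply: h1 => // [p /andP [/HQ [pp ps] pD]|]; [split | apply: ltnW].
have D1 : (0 < `|D|)%N by rewrite absz_gt0.
have h2 : ln (((1 + `|D|) * s.+1 ^ 2)%N%:R : R) <= ln N%:R + (3 + 4 * `|D|)%N%:R.
  apply: le_trans (_ : ln (((4 * (1 + `|D|)) * N)%N%:R) <= _).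
    apply: ler_ln_nat; first by rewrite muln_gt0.
    rewrite mulnAC mulnC leq_mul2r; apply/orP; right.
    apply: leq_trans (_ : (2 * s) ^ 2 <= _)%N; first by rewrite leq_exp2r //; lia.
    by rewrite expnMn leq_mul2l.
  rewrite natrM lnM ?posrE ?ltr0n ?muln_gt0 // addrC lerD2l.
  have -> : (4 * (1 + `|D|) = (3 + 4 * `|D|).+1)%N by lia.
  exact: ln_nat_le.
have h3 : \sum_(p < N.+1 | Q p && (p %| 2 * `|D|)%N) ln (p%:R : R) / p%:R <= (2 * `|D|).-1%:R.
  apply: le_trans (_ : \sum_(p < N.+1 | Q p && (p %| 2 * `|D|)%N) 1 * ln (p%:R : R) <= _).
    apply: ler_sum => p /andP [/HQ [/prime_gt0 pp _] _].
    rewrite mul1r ler_pdivrMr ?ltr0n // ler_peMr ?ln_nat_ge0 //.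
    by rewrite ler1n.
  apply: le_trans (@sum_logn_le R (2 * `|D|) N (fun p => Q p && (p %| 2 * `|D|)%N) (fun=> 1) _ _) _.
  - by rewrite muln_gt0.
  - move=> p /andP [/HQ [pp _] pD]; split=> //.
    by rewrite ler1n -pfactor_dvdn ?expn1 // muln_gt0.
  - by have := ln_nat_le R (2 * `|D|).-1; rewrite prednK // muln_gt0.
have : (2 * `|D|).-1%:R = 2 * `|D|%N%:R - 1 :> R.
  by rewrite -subn1 natrB ?natrM // muln_gt0.
have d0 := ler0n R `|D|%N.
by move: h1 h2; set L := ln (_ * _)%N%:R; rewrite natrD natrM; lra.
Qed.

(** The valuation of [N!] is at most [N / (p - 1)], and [1 / (p - 1) = 1 / p + 1 / (p * (p - 1))]:
    the first part is summed by [split_ln_le], the second by the convergent series of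
    [ln_div_le]. *)
Lemma split_fact_le N (Q : pred nat) : (0 < N)%N -> D != 0 ->
  (forall p, Q p -> prime p /\ exists s : int, (p %| s ^+ 2 - D)%Z) ->
  2 * \sum_(p < N.+1 | Q p) (logn p N`!)%:R * ln (p%:R : R)
   <= N%:R * (ln N%:R + 14 + 8 * `|D|%N%:R).
Proof.
move=> N0 D0 HQ.
have h1 := split_ln_le N0 D0 HQ.
have h2 := ln_div_le R N0.
have n0 : 0 < N%:R :> R by rewrite ltr0n.
have h3 : (ln N%:R + 2) / N%:R >= 0 :> R.
  by rewrite divr_ge0 ?(ltW n0) // addr_ge0 ?ln_nat_ge0.
have h : \sum_(p < N.+1 | Q p) (logn p N`!)%:R * ln (p%:R : R) <=
  N%:R * ((\sum_(p < N.+1 | Q p) ln (p%:R : R) / p%:R)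
   + \sum_(p < N.+1 | (1 < p)%N) ln (p%:R : R) / (p%:R * p.-1%:R)).
  apply: le_trans (_ : N%:R * \sum_(p < N.+1 | Q p) (ln (p%:R : R) / p%:R + ln (p%:R : R) / (p%:R * p.-1%:R)) <= _).
    rewrite mulr_sumr; apply: ler_sum => p /HQ [pp _].
    have p1 : 0 < p.-1%:R :> R by rewrite ltr0n -subn1 subn_gt0 prime_gt1.
    have p0 : 0 < p%:R :> R by rewrite ltr0n prime_gt0.
    have pE : p%:R = p.-1%:R + 1 :> R by rewrite natr1 prednK // prime_gt0.
    have -> : ln (p%:R : R) / p%:R + ln p%:R / (p%:R * p.-1%:R) = ln p%:R / p.-1%:R.
      by set L := ln _; rewrite pE; field; rewrite -pE !gt_eqF.
    rewrite mulrA mulrAC ler_wpM2r ?ln_nat_ge0 // ler_pdivlMr // mulrC -natrM ler_nat.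
    exact: logn_fact_le.
  rewrite ler_pM2l // big_split lerD2l big_mkcond [leRHS]big_mkcond.
  apply: ler_sum => p _; case: ifP => [/HQ [/prime_gt1 -> //]|_].
  by case: ifP => // _; rewrite divr_ge0 ?ln_nat_ge0 // mulr_ge0.
apply: le_trans (_ : 2 * (N%:R * (ln N%:R / 2 + 5 + 4 * `|D|%N%:R + 2)) <= _).
  rewrite ler_pM2l //; apply: le_trans h _; rewrite ler_pM2l //; lra.
by rewrite mulrCA ler_pM2l //; lra.
Qed.
End SplitPrimes.

(** * Valuations of products over consecutive integers *)

Section ConsecutiveValuations.
Local Open Scope nat_scope.
Implicit Types (p N B : nat).

Lemma logn_factE p n : logn p n`! = \sum_(0 <= i < n) logn p i.+1.
Proof.
elim: n => [|n IH]; first by rewrite big_nil logn1.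
by rewrite big_nat_recr //= -IH factS lognM ?fact_gt0 // addnC.
Qed.

Lemma logn_fact_leq p m n : m <= n -> logn p m`! <= logn p n`!.
Proof.
move=> le; apply: dvdn_leq_log; first exact: fact_gt0.
by apply/dvdnP; exists (n ^_ (n - m)); rewrite -(ffact_fact (leq_subr m n)) subKn.
Qed.

(** The distances to [j] multiply to [j!] on the left and [(N - 1 - j)!] on the right, and the
    product of the two divides [(N - 1)!]. *)
Lemma sum_logn_dist p N (j : 'I_N) :
  \sum_(i < N | i != j) logn p `|(i%:Z - j%:Z)%R| <= logn p N`!.
Proof.
have jN := ltn_ord j.
pose F i := logn p `|(i%:Z - j%:Z)%R|.
have -> : \sum_(i < N | i != j) logn p `|(i%:Z - j%:Z)%R| = \sum_(0 <= i < N | i != j) F i.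
  by rewrite big_mkord.
rewrite (@big_cat_nat _ _ _ j) //=; last exact: ltnW.
rewrite [X in _ + X <= _]big_ltn_cond //= eqxx /=.
have -> : \sum_(0 <= i < j | i != j) F i = logn p j`!.
  rewrite logn_factE big_nat_cond [RHS]big_nat_rev /= [RHS]big_nat_cond.
  apply: eq_big => [i|i h]; first by case: ltngtP.
  by rewrite /F add0n; congr logn; lia.
have -> : \sum_(j.+1 <= i < N | i != j) F i = logn p (N.-1 - j)`!.
  rewrite (_ : N.-1 - j = N - j.+1); last by lia.
  rewrite logn_factE -{1}[j.+1]add0n big_addn big_nat_cond [RHS]big_nat_cond.
  apply: eq_big => [i|i h]; last by rewrite /F; congr logn; lia.
  by lia.
have le : j <= N.-1 by lia.
rewrite -lognM ?fact_gt0 //.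
apply: leq_trans (logn_fact_leq p (leq_pred N)).
apply: dvdn_leq_log; first exact: fact_gt0.
by rewrite -(bin_fact le) dvdn_mull.
Qed.

(* The term of largest p-adic valuation is set aside: the valuation of any other
   term is at most that of its difference with it. *)
Lemma sum_logn_consecutive p N B : prime p -> 0 < N -> 0 < B ->
  exists2 j, j < N & \sum_(i < N) logn p (B + i) <= logn p N`! + logn p (B + j).
Proof.
move=> pp N0 B0.
pose j := [arg max_(i > Ordinal N0) logn p (B + i)].
have jmax (i : 'I_N) : logn p (B + i) <= logn p (B + j).
  by rewrite /j; case: arg_maxnP => // k _; apply.
exists j; first exact: ltn_ord.
rewrite (bigD1 j) //= addnC leq_add2r.
apply: leq_trans (sum_logn_dist p j); apply: leq_sum => i ij.
rewrite -pfactor_dvdn //; last first.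
  by rewrite absz_gt0 subr_eq0; apply: contraNneq ij => h; apply/eqP/val_inj => /=; lia.
have h1 : ((p ^ logn p (B + i))%N%:Z %| (B + i)%N%:Z)%Z by rewrite dvdzE pfactor_dvdnn.
have h2 : ((p ^ logn p (B + i))%N%:Z %| (B + j)%N%:Z)%Z.
  by rewrite dvdzE pfactor_dvdn ?addn_gt0 ?B0 //.
have := rpredB h1 h2; rewrite dvdzE /=; congr (_ %| _).
by lia.
Qed.

Definition quad (a c k : int) : int := (k ^+ 2 - a * k + c)%R.

(** Again the term [q j] of largest valuation is set aside. The difference [q i - q j] factors as
    [(i - j) * (B + i)], so the remaining valuations are bounded by those of distances and of
    consecutive integers, each giving one [N!]. The bound on [a] makes [B] positive. *)
Lemma sum_logn_quad (a c : int) p l N : prime p -> 0 < N -> `|a| <= l ->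
  (forall i, i < N -> quad a c (l + 1 + i)%:Z != 0%R) ->
  exists j j' : nat, [/\ j < N, j' <= 2 * (l + N) + `|a|, 0 < j' &
   \sum_(i < N) logn p `|quad a c (l + 1 + i)%:Z| <=
     2 * logn p N`! + logn p `|quad a c (l + 1 + j)%:Z| + logn p j'].
Proof.
move=> pp N0 al q0.
pose q (i : nat) := quad a c (l + 1 + i)%:Z.
pose j := [arg max_(i > Ordinal N0) logn p `|q i|].
have jmax (i : 'I_N) : logn p `|q i| <= logn p `|q j|.
  by rewrite /j; case: arg_maxnP => // k _; apply.
have jN := ltn_ord j.
pose B := `|((2 * l + 2 + j)%:Z - a)%R|.
have B0 : 0 < B by rewrite /B; lia.
have [j' j'N hj'] := sum_logn_consecutive pp N0 B0.
exists j, (B + j'); split=> //; first by rewrite /B; lia.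
  by rewrite addn_gt0 B0.
rewrite (bigD1 j) //= addnC.
suff h : \sum_(i < N | i != j) logn p `|q i| <= logn p N`! + \sum_(i < N) logn p (B + i).
  by apply: leq_trans (leq_add h (leqnn _)) _; lia.
apply: leq_trans (_ : \sum_(i < N | i != j) (logn p `|(i%:Z - j%:Z)%R| + logn p (B + i)) <= _); last first.
  rewrite big_split /=; apply: leq_add; first exact: sum_logn_dist.
  by rewrite [X in _ <= X](bigID (fun i => i != j)) /= leq_addr.
apply: leq_sum => i ij.
have d0 : 0 < `|(i%:Z - j%:Z)%R|.
  by rewrite absz_gt0 subr_eq0; apply: contraNneq ij => h; apply/eqP/val_inj => /=; lia.
have Bi : 0 < B + i by rewrite addn_gt0 B0.
rewrite -lognM // -pfactor_dvdn ?muln_gt0 ?d0 //.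
have h1 : ((p ^ logn p `|q i|)%N%:Z %| q i)%Z by rewrite dvdzE pfactor_dvdnn.
have h2 : ((p ^ logn p `|q i|)%N%:Z %| q j)%Z.
  by rewrite dvdzE pfactor_dvdn // absz_gt0 q0.
have := rpredB h1 h2.
have -> : (q i - q j = (i%:Z - j%:Z) * (B + i)%:Z)%R.
  have -> : (B + i)%:Z = ((2 * l + 2 + j)%:Z - a + i)%R by rewrite /B; lia.
  by rewrite /q /quad !PoszD; ring.
by rewrite dvdzE abszM.
Qed.

End ConsecutiveValuations.

(** * Large prime divisors of quadratic values *)

Section ChebyshevQuadratic.
Variable R : realType.

Lemma logn_ln_le p n m : (0 < n)%N -> (n <= m)%N -> prime p ->
  (logn p n)%:R * ln (p%:R : R) <= ln m%:R.
Proof.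
move=> n0 nm pp; apply: le_trans (ler_ln_nat R n0 nm).
have -> : (logn p n)%:R * ln (p%:R : R) = ln (p ^ logn p n)%N%:R.
  by rewrite natrX lnXn ?ltr0n ?prime_gt0 // -[RHS]mulr_natl.
apply: ler_ln_nat; first by rewrite expn_gt0 prime_gt0.
by apply: dvdn_leq => //; apply: pfactor_dvdnn.
Qed.

(** Since [4 * q = (2k - a) ^ 2 - D], a prime dividing some value has [D] as a square, so
    [split_fact_le] bounds the factorial parts from [sum_logn_quad]. The two exceptional terms cost
    at most [ln Qm + ln Ym] for each prime up to [X]. *)
Lemma chebyshev_quad (a c D : int) (l N X Qm Ym : nat) :
  D = a ^+ 2 - 4 * c ->
  (forall x y : int, x ^+ 2 = D * y ^+ 2 -> x = 0 /\ y = 0) ->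
  (0 < N)%N -> (N <= X)%N -> (`|a| <= l)%N ->
  (forall i p, (i < N)%N -> prime p -> (p %| `|quad a c (l + 1 + i)%:Z|)%N -> (p <= X)%N) ->
  (forall i, (i < N)%N -> `|quad a c (l + 1 + i)%:Z| <= Qm)%N ->
  (2 * (l + N) + `|a| <= Ym)%N ->
  \sum_(i < N) ln (`|quad a c (l + 1 + i)%:Z|%N%:R : R) <=
    N%:R * (ln N%:R + 14 + 8 * `|D|%N%:R) + \sum_(p < X.+1 | prime p) (ln Qm%:R + ln Ym%:R).
Proof.
move=> DE D_nsq N0 NX al HX HQ HY.
have D0 : D != 0.
  by apply/eqP => E; have [_ /eqP] : 0 = 0 :> int /\ 1 = 0 :> int by apply: D_nsq; rewrite E; ring.
have q4 k : 4 * quad a c k = (2 * k - a) ^+ 2 - D by rewrite DE /quad; ring.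
have q0 k : quad a c k != 0.
  apply/eqP => E; have := q4 k; rewrite E mulr0 => /esym/eqP; rewrite subr_eq0 => /eqP E'.
  by have [_ /eqP] : 2 * k - a = 0 /\ 1 = 0 :> int by apply: D_nsq; rewrite E'; ring.
pose q (i : nat) := `|quad a c (l + 1 + i)%:Z|%N.
have qp i : (0 < q i)%N by rewrite absz_gt0.
have -> : \sum_(i < N) ln ((q i)%:R : R) =
   \sum_(p < X.+1 | prime p) (\sum_(i < N) logn p (q i))%N%:R * ln p%:R.
  under eq_bigr => i _ do rewrite (@ln_logn R _ X (qp i) (fun p => HX i p (ltn_ord i))).
  rewrite exchange_big; apply: eq_bigr => p _ /=.
  by rewrite natr_sum mulr_suml.
pose Q p := prime p && [exists i : 'I_N, (p %| q i)%N].
have HQs p : Q p -> prime p /\ exists s : int, (p %| s ^+ 2 - D)%Z.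
  move=> /andP [pp /existsP [i pi]]; split=> //.
  exists (2 * (l + 1 + i)%:Z - a); rewrite -q4; apply: dvdz_mull.
  by rewrite dvdzE.
have h : forall p, prime p -> (\sum_(i < N) logn p (q i))%N%:R * ln (p%:R : R) <=
    (if Q p then 2 * ((logn p N`!)%:R * ln p%:R) else 0) + (ln Qm%:R + ln Ym%:R).
  move=> p pp; case: ifP => [_|]; last first.
    rewrite /Q pp /= => /negbT /existsPn np.
    rewrite big1 ?mul0r ?add0r ?addr_ge0 ?ln_nat_ge0 // => i _.
    by rewrite lognE (negbTE (np i)) !andbF.
  have [j [j' [jN j'Y j'0 le]]] := sum_logn_quad pp N0 al (fun i _ => q0 (l + 1 + i)%:Z).
  have H1 := logn_ln_le (qp j) (HQ j jN) pp.
  have H2 := logn_ln_le j'0 (leq_trans j'Y HY) pp.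
  move: le; rewrite -/(q j) -(ler_nat R) => /(ler_wpM2r (ln_nat_ge0 R p)) le.
  by apply: le_trans le _; rewrite 2!natrD natrM !mulrDl; lra.
apply: le_trans (ler_sum _ (fun (p : 'I_X.+1) (pp : prime p) => h p pp)) _.
rewrite big_split /= lerD2r.
apply: le_trans (split_fact_le R D_nsq N0 D0 HQs).
rewrite mulr_sumr -big_mkcondr /=.
rewrite (big_ord_widen_cond X.+1 Q (fun p => 2 * ((logn p N`!)%:R * ln (p%:R : R)))) //.
rewrite big_mkcond [leRHS]big_mkcond; apply: ler_sum => p _.
case: ifP => [/andP [pp Qp]|_]; last first.
  by case: ifP => // _; rewrite !mulr_ge0 ?ln_nat_ge0.
rewrite Qp /=; case: ltnP => // pN.
suff -> : logn p N`! = 0%N by rewrite mul0r mulr0.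
apply/eqP; rewrite -leqn0 leqNgt -pfactor_dvdn ?fact_gt0 // expn1.
by apply/negP => /(prime_dvd_fact pp); rewrite leqNgt pN.
Qed.
End ChebyshevQuadratic.

Lemma ln2_ge (R : realType) : 2^-1 <= ln (2 : R).
Proof.
have h : -1 < - 2^-1 :> R by lra.
have := le_ln1Dx h.
have -> : 1 - 2^-1 = 2^-1 :> R by lra.
by rewrite lnV ?posrE ?ltr0n //; lra.
Qed.

(** Here [m], [L] and [L'] stand for [N], [ln n] and [ln N]. Cancelling [m] leaves
    [L <= 17 + 8 * d + 1440 * w * (d + 1)], which is at most [2905 * w ^ 2] and contradicts the
    constant 3001. *)
Lemma large_prime_numerics (R : realType) (w d m n L L' : R) :
  1 <= w -> d <= w -> 0 < m -> L' <= L -> 3001 * (w * w) <= L ->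
  n <= m * (8 * (d + 1)) ->
  m * (2 * L - 3) <= m * (L' + 14 + 8 * d) + 3 * (10 * (6 * w * n)) -> False.
Proof.
move=> w1 dw m0 LL Lw nm main.
have h1 : 180 * w * n <= 180 * w * (m * (8 * (d + 1))) by rewrite ler_wpM2l //; lra.
have h2 : m * (2 * L - 3) <= m * (L + 14 + 8 * d + 1440 * w * (d + 1)).
  have : m * (L' + 14 + 8 * d) <= m * (L + 14 + 8 * d) by rewrite ler_pM2l //; lra.
  lra.
rewrite ler_pM2l // in h2.
have h3 : w * (d + 1) <= w * (w + 1) by rewrite ler_wpM2l //; lra.
have h4 : w <= w * w by rewrite ler_peMl //; lra.
lra.
Qed.

(* The bound on [n] gives [ln n >= 3001 W^2], which exceeds the sum of the constants
   in [chebyshev_quad] and [primes_ln_le]. *)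
Lemma large_prime_divisor (R : realType) (a c D : int) (W n : nat) :
  D = a ^+ 2 - 4 * c ->
  (forall x y : int, x ^+ 2 = D * y ^+ 2 -> x = 0 /\ y = 0) ->
  (`|a| <= W)%N -> (`|c| <= W)%N -> (`|D| <= W)%N ->
  (2 ^ (2 * 3001 * W ^ 2) <= n)%N ->
  exists p k, [/\ prime p, (6 * W * n < p)%N,
    (n <= k + n %/ (4 * `|D|.+1) + 2 * W)%N, (k + 2 * W < n)%N &
    (p %| `|quad a c k%:Z|)%N].
Proof.
move=> DE D_nsq aW cW DW nW.
have D0 : (0 < `|D|)%N.
  rewrite absz_gt0; apply/eqP => E.
  by have [_ /eqP] : 0 = 0 :> int /\ 1 = 0 :> int by apply: D_nsq; rewrite E; ring.
have W0 : (0 < W)%N by apply: leq_trans DW.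
have n_big : (2 * 3001 * W ^ 2 < n)%N by apply: leq_trans nW; apply: ltn_expl.
have WW : (W <= W ^ 2)%N by rewrite -{1}(expn1 W) leq_pexp2l.
set N := (n %/ _)%N.
have N4 : (N * (4 * `|D|.+1) <= n)%N by apply: leq_trunc_div.
have N4' : (n < N.+1 * (4 * `|D|.+1))%N by apply: ltn_ceil.
have N8 : (8 * N <= n)%N.
  by apply: leq_trans N4; rewrite mulnC leq_mul2l; lia.
have DWW : (4 * `|D|.+1 <= 8 * W ^ 2)%N by lia.
have N0 : (0 < N)%N by rewrite divn_gt0 // (leq_trans DWW) // (leq_trans _ (ltnW n_big)) // leq_mul2r orbT.
have N8' : (n <= N * (8 * `|D|.+1))%N.
  apply: leq_trans (ltnW N4') _; rewrite (_ : N * (8 * `|D|.+1) = (2 * N) * (4 * `|D|.+1))%N ?leq_mul2r; lia.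
pose X := (6 * W * n)%N.
have nW200 : (200 * W <= n)%N.
  apply: leq_trans (ltnW n_big); apply: leq_mul => //.
have n0 : (0 < n)%N by apply: leq_ltn_trans n_big.
clearbody N; clear N4 N4' DWW n_big.
(* The [N] indices examined end at [n - 2 * W - 1]; the gap leaves room for comparing shifted
   quadratics. *)
have [l lE] : exists l, n = (l + 1 + N + 2 * W)%N.
  by exists (n - N - 2 * W - 1)%N; clear -nW200 N8 n0; lia.
have [[i [p [iN pp pq pX]]]|H] := pselect (exists i p, [/\ (i < N)%N, prime p,
     (p %| `|quad a c (l + 1 + i)%N%:Z|)%N & (X < p)%N]).
  exists p, (l + 1 + i)%N; split=> //; clear -lE iN; lia.
(* Otherwise all prime factors of the values are at most [X]. Each value is at least [n ^ 2 / 4],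
   and the resulting lower bound for the sum of logarithms contradicts [chebyshev_quad]. *)
have HX i p : (i < N)%N -> prime p -> (p %| `|quad a c (l + 1 + i)%N%:Z|)%N -> (p <= X)%N.
  by move=> iN pp pq; rewrite leqNgt; apply/negP => lt; apply: H; exists i, p.
have HQ i : (i < N)%N -> (`|quad a c (l + 1 + i)%N%:Z| <= 3 * n ^ 2)%N.
  move=> iN; have : (l + 1 + i <= n)%N by clear -lE iN; lia.
  move: (l + 1 + i)%N => k kn; rewrite /quad.
  have h1 : (`|(a * k%:Z)%R| <= n * n)%N.
    by rewrite abszM; apply: leq_mul => //; clear -aW nW200; lia.
  have h2 : (k * k <= n * n)%N by apply: leq_mul.
  have h3 : (`|c| <= n * n)%N.
    by apply: leq_trans (leq_pmull n n0); clear -cW nW200; lia.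
  have h4 : `|(k%:Z ^+ 2)%R|%N = (k * k)%N by rewrite abszX mulnn.
  by rewrite -mulnn; clear -h1 h2 h3 h4; lia.
have Hq i : (i < N)%N -> (n ^ 2 <= 4 * `|quad a c (l + 1 + i)%N%:Z|)%N.
  move=> iN; have : (3 * n <= 4 * (l + 1 + i))%N by clear -lE nW200 N8; lia.
  move: (l + 1 + i)%N => k kn; rewrite /quad.
  have k16 : (12 * W <= k)%N by clear -kn nW200; lia.
  have k0 : (0 < k)%N by clear -k16 W0; lia.
  have h1 : (`|(a * k%:Z)%R| <= W * k)%N by rewrite abszM leq_mul.
  have h4 : `|(k%:Z ^+ 2)%R|%N = (k * k)%N by rewrite abszX mulnn.
  have h5 : (12 * W * k <= k * k)%N by rewrite leq_mul2r k16 orbT.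
  have h6 : ((3 * n) * (3 * n) <= (4 * k) * (4 * k))%N by apply: leq_mul.
  have h7 : (12 * W <= k * k)%N by apply: leq_trans (leq_pmull k k0).
  by rewrite -mulnn; clear -h1 h4 h5 h6 h7 cW; lia.
have NX : (N <= X)%N.
  apply: leq_trans (_ : n <= _)%N; first by clear -N8; lia.
  by rewrite /X leq_pmull // muln_gt0.
have al : (`|a| <= l)%N by clear -aW nW200 N8 lE W0; lia.
have Ym : (2 * (l + N) + `|a| <= 3 * n)%N by clear -lE aW nW200; lia.
have := @chebyshev_quad R a c D l N X (3 * n ^ 2) (3 * n) DE D_nsq N0 NX al HX HQ Ym.
have ln4 : ln (4%:R : R) <= 3 by apply: ln_nat_le.
have lnn2 : ln ((n ^ 2)%N%:R : R) = 2 * ln n%:R.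
  by rewrite natrX lnXn ?ltr0n // mulr_natl.
have low : N%:R * (2 * ln n%:R - 3) <= \sum_(i < N) ln (`|quad a c (l + 1 + i)%N%:Z|%N%:R : R).
  have -> : N%:R * (2 * ln n%:R - 3) = \sum_(i < N) (2 * ln n%:R - 3) :> R.
    by rewrite sumr_const card_ord mulr_natl.
  apply: ler_sum => i _; have h := Hq i (ltn_ord i).
  have n20 : (0 < n ^ 2)%N by rewrite expn_gt0 n0.
  have := ler_ln_nat R n20 h; rewrite lnn2 natrM lnM ?posrE ?ltr0n //; first lra.
  by case: (absz _) h => // /(leq_trans n20).
have up : \sum_(p < X.+1 | prime p) (ln (3 * n ^ 2)%N%:R + ln (3 * n)%N%:R) <= 3 * (10 * X%:R) :> R.
  apply: le_trans (_ : 3 * \sum_(p < X.+1 | prime p) ln (X%:R : R) <= _).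
    rewrite mulr_sumr; apply: ler_sum => p _.
    rewrite -lnM ?posrE ?ltr0n ?muln_gt0 ?expn_gt0 ?n0 // -natrM.
    have -> : 3 * ln X%:R = ln (X ^ 3)%N%:R :> R.
      by rewrite natrX lnXn ?mulr_natl // ltr0n /X !muln_gt0 W0 n0.
    apply: ler_ln_nat; first by rewrite !muln_gt0 n0.
    have -> : (3 * n ^ 2 * (3 * n) = 9 * n ^ 3)%N by rewrite !expnS expn0; clear; lia.
    by rewrite /X expnMn leq_mul2r; apply/orP; right; rewrite expnMn; have : (0 < W ^ 3)%N; [rewrite expn_gt0 W0 | clear; lia].
  by rewrite ler_pM2l //; apply: primes_ln_le.
have lnN : ln N%:R <= ln n%:R :> R by apply: ler_ln_nat => //; clear -N8; lia.
(* The factor 2 in the exponent compensates for the estimate [ln 2 >= 1/2]. *)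
have lnn : (2 * 3001 * W ^ 2)%N%:R / 2 <= ln n%:R :> R.
  have p2 : (0 < 2 ^ (2 * 3001 * W ^ 2))%N by rewrite expn_gt0.
  apply: le_trans (ler_ln_nat R p2 nW); rewrite natrX lnXn ?ltr0n // -[leRHS]mulr_natl.
  by rewrite ler_wpM2l // ln2_ge.
move=> main; have {main} := le_trans low (le_trans main (lerD (lexx _) up)).
have N0' : 0 < N%:R :> R by rewrite ltr0n.
have -> : X%:R = 6 * W%:R * n%:R :> R by rewrite /X !natrM.
have : n%:R <= N%:R * (8 * (`|D|%N%:R + 1)) :> R.
  by move: N8'; rewrite -(ler_nat R) !natrM -[`|D|.+1%:R]natr1.
have : `|D|%N%:R <= W%:R :> R by rewrite ler_nat.
have : 1 <= W%:R :> R by rewrite ler1n.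
move: lnn; rewrite natrM natrM.
move: lnN; set L := ln n%:R; set w := W%:R; set d := `|D|%N%:R; set m := N%:R; set L' := ln m.
move=> lnN lnn w1 dw nm main.
exfalso; apply: (large_prime_numerics w1 dw N0' lnN _ nm main).
by move: lnn; rewrite -mulnn natrM; lra.
Qed.

(** * Comparison of discriminants *)

Definition disc (x : int * int) : int := x.1 ^+ 2 - 4 * x.2.

Definition qval (x : int * int) (k : int) : int := quad x.1 x.2 k.

Lemma qval_disc x k : 4 * qval x k = (2 * k - x.1) ^+ 2 - disc x.
Proof. by rewrite /qval /quad /disc; ring. Qed.

(** Equal discriminants force the linear coefficients to have the same parity. *)
Lemma disc_shift (x x' : int * int) : disc x = disc x' -> x.1 <= x'.1 ->
  exists s : nat, x'.1 = x.1 + 2 * s%:Z.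
Proof.
move=> eD le.
have : (2 %| (x'.1 - x.1) ^+ 2)%Z.
  have -> : (x'.1 - x.1) ^+ 2 = 2 * (x'.1 ^+ 2 - x'.1 * x.1 + 2 * (x.2 - x'.2)).
    have : x.1 ^+ 2 - 4 * x.2 = x'.1 ^+ 2 - 4 * x'.2 by [].
    have -> : (x'.1 - x.1) ^+ 2 = x'.1 ^+ 2 - 2 * (x'.1 * x.1) + x.1 ^+ 2 by ring.
    by clear; lia.
  exact: dvdz_mulr.
rewrite dvdzE abszX Euclid_dvdX // andbT => /dvdnP [s sE].
by exists s; clear -sE le; lia.
Qed.

(** * Indices at which a large prime can divide *)

Section Window.
Variables (W n N p : nat) (y D0 : int).
Hypotheses (pp : prime p) (p_big : (6 * W * n < p)%N) (y_root : (p %| y ^+ 2 - D0)%Z).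
Hypotheses (D0_neq0 : D0 != 0) (D0W : (`|D0| <= W)%N) (n_big : (12 * (W * W) < n)%N).
Hypothesis N_small : (N * (4 * `|D0|.+1) <= n)%N.
Hypotheses (y_ge : 2 * n%:Z <= y + 2 * N%:Z + 5 * W%:Z) (y_le : y <= 2 * n%:Z - 2 * W%:Z).

(* [z := 2k - x.1] satisfies [(z * D0)^2 = (w * y)^2] modulo the large prime [p],
   hence exactly, so that [|z| / y] is the fixed ratio [w / |D0|]. *)
Lemma root_in_window (x : int * int) (w : int) (k : nat) :
  (`|x.1| <= W)%N -> 0 <= w -> disc x * D0 = w ^+ 2 -> (`|disc x| <= W)%N ->
  (0 < k <= n)%N -> (p %| qval x k)%Z -> qval x k != 0 ->
  [/\ disc x != 0, (`|disc x| <= `|D0|)%N, W%:Z < 2 * k%:Z - x.1 & 2 * k%:Z - x.1 <= 2 * n%:Z - 2 * W%:Z].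
Proof.
move=> aW w0 Dw DW kn pq q0.
have q4 := qval_disc x k.
set D := disc x in Dw DW q4 *.
set z := 2 * k%:Z - x.1 in q4 *.
have W0 : (0 < W)%N by rewrite (leq_trans _ D0W) // absz_gt0.
have d0 : (0 < `|D0|)%N by rewrite absz_gt0.
have zb : (`|z| <= 2 * n + W)%N by rewrite /z; clear -aW kn; lia.
have z_low : - W%:Z < z by rewrite /z; clear -aW kn; lia.
have wW : (`|w| <= W)%N.
  have : (`|w| * `|w| <= W * W)%N.
    by rewrite -abszM -expr2 -Dw abszM; apply: leq_mul.
  by clear; nia.
have WWn : (W <= W * W)%N by rewrite leq_pmull.
have y_low : n%:Z <= y.
  have : (8 * N <= n)%N by apply: leq_trans N_small; rewrite mulnC leq_mul2l; clear -d0; lia.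
  by clear -n_big y_ge WWn; lia.
have y0 : 0 < y by clear -y_low n_big; lia.
have prodE : (z * D0 - w * y) * (z * D0 + w * y) =
   D0 ^+ 2 * (z ^+ 2 - D) - D * D0 * (y ^+ 2 - D0).
  have -> : (z * D0 - w * y) * (z * D0 + w * y) = D0 ^+ 2 * z ^+ 2 - w ^+ 2 * y ^+ 2 by ring.
  by rewrite -Dw; ring.
have pprod : (p %| (z * D0 - w * y) * (z * D0 + w * y))%Z.
  rewrite prodE; apply: rpredB; apply: dvdz_mull => //.
  by rewrite -q4 dvdz_mull.
(* Both [|z|] and [|y|] are at most [3 * n], both [|D0|] and [|w|] at most [W]; this is where
   [6 * W * n < p] comes from. The factor divisible by [p] is then 0. *)
have bound : (`|z| * `|D0| + `|w| * `|y| < p)%N.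
  apply: leq_ltn_trans p_big.
  have h1 : (`|z| * `|D0| <= (3 * n) * W)%N by apply: leq_mul => //; clear -zb n_big WWn; lia.
  have h2 : (`|w| * `|y| <= W * (3 * n))%N by apply: leq_mul => //; clear -y0 y_le; lia.
  by clear -h1 h2; lia.
have small u v : (p %| u + v)%Z -> (`|u| + `|v| < p)%N -> u + v = 0.
  move=> pu lt; apply/eqP; rewrite -absz_eq0 -leqn0 leqNgt; apply/negP => h.
  have := dvdn_leq h pu; clear -lt; lia.
have zwy : (`|z| * `|D0| = `|w| * `|y|)%N.
  rewrite -!abszM; move: pprod; rewrite dvdzE abszM Euclid_dvdM // => /orP [h|h].
    have : z * D0 + - (w * y) = 0 by apply: small => //; rewrite abszN !abszM.
    by clear; lia.
  have : z * D0 + w * y = 0 by apply: small => //; rewrite !abszM.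
  by clear; lia.
have yE : `|y|%N%:Z = y by clear -y0; lia.
have Y0 : (0 < `|y|)%N by clear -y0; lia.
have Dn0 : D != 0.
  apply: contraNneq q0 => E; move: Dw; rewrite E mul0r => /esym/eqP; rewrite sqrf_eq0 => /eqP w0'.
  move: zwy; rewrite w0' mul0n => /eqP; rewrite muln_eq0 (gtn_eqF d0) orbF absz_eq0 => /eqP z0.
  have : 4 * qval x k = 0 by rewrite q4 E z0; ring.
  by clear; lia.
have w2 : (`|D| * `|D0| = `|w| * `|w|)%N by rewrite -!abszM Dw expr2.
have w1 : (0 < `|w|)%N.
  by rewrite absz_gt0 -sqrf_eq0 -Dw mulf_neq0.
have zW : (W < `|z|)%N.
  have h1 : (W * W < `|y|)%N by clear -y_low n_big; lia.
  have h2 : (`|y| <= `|z| * `|D0|)%N by rewrite zwy leq_pmull.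
  have h3 : (`|z| * `|D0| <= `|z| * W)%N by rewrite leq_mul2l D0W orbT.
  have := leq_trans h1 (leq_trans h2 h3).
  by rewrite ltn_mul2r => /andP [].
have z0 : z = `|z|%N by clear -zW z_low; lia.
(* Were [|D|] larger, [|w|] would be at least [|D0| + 1], so [|z|] would exceed [|y|] by a factor
   [1 + 1 / |D0|]. As [y] is close to [2 * n], within the margin granted by [N_small], this
   contradicts [|z| <= 2 * n + W]. *)
have DD0 : (`|D| <= `|D0|)%N.
  rewrite leqNgt; apply/negP => lt.
  have wd : (`|D0| < `|w|)%N.
    rewrite ltnNge; apply/negP => le.
    have : (`|w| * `|w| <= `|D0| * `|D0|)%N by apply: leq_mul.
    by rewrite -w2 leq_mul2r (gtn_eqF d0) /= leqNgt lt.
  have h1 : (`|D0|.+1 * `|y| <= `|z| * `|D0|)%N by rewrite zwy leq_mul2r wd orbT.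
  have h2 : (`|z| * `|D0| <= (2 * n + W) * `|D0|)%N by rewrite leq_mul2r zb orbT.
  have h3 : (`|D0|.+1 * (2 * n) <= `|D0|.+1 * (`|y| + 2 * N + 5 * W))%N.
    by rewrite leq_mul2l; clear -y_ge yE; lia.
  have h4 : (W * `|D0| <= W * W)%N by rewrite leq_mul2l D0W orbT.
  by clear -h1 h2 h3 h4 n_big N_small WWn; lia.
split=> //; first by clear -z0 zW; lia.
have wd : (`|w| <= `|D0|)%N.
  rewrite leqNgt; apply/negP => lt.
  have : (`|D0| * `|D0| < `|w| * `|w|)%N by apply: ltn_mul.
  by rewrite -w2 ltn_mul2r d0 /= ltnNge DD0.
have : (`|z| * `|D0| <= `|y| * `|D0|)%N by rewrite zwy mulnC leq_mul2l wd orbT.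
by rewrite leq_mul2r (gtn_eqF d0) /=; clear -z0 yE y_le; lia.
Qed.

Definition val_sum (x : int * int) : nat := \sum_(0 <= k < n) logn p `|qval x k.+1%:Z|.

(* Two quadratics with the same discriminant are integer shifts of each other. *)
Lemma val_sum_shift (x x' : int * int) :
  (forall k : nat, (0 < k <= n)%N -> (0 < logn p `|qval x k%:Z|)%N ->
     W%:Z < 2 * k%:Z - x.1 /\ 2 * k%:Z - x.1 <= 2 * n%:Z - 2 * W%:Z) ->
  (forall k : nat, (0 < k <= n)%N -> (0 < logn p `|qval x' k%:Z|)%N ->
     W%:Z < 2 * k%:Z - x'.1 /\ 2 * k%:Z - x'.1 <= 2 * n%:Z - 2 * W%:Z) ->
  disc x = disc x' -> (`|x.1| <= W)%N -> (`|x'.1| <= W)%N ->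
  val_sum x = val_sum x'.
Proof.
wlog le : x x' / x.1 <= x'.1.
  move=> H; have [/H//|/ltW /H h] := lerP x.1 x'.1.
  by move=> h1 h2 e1 e2 e3; rewrite h.
move=> Hx Hx' eD aW a'W.
have [s sE] := disc_shift eD le.
have shift k : qval x' (k + s%:Z) = qval x k.
  apply: (mulfI (isT : (4 : int) != 0)); rewrite !qval_disc eD; congr (_ ^+ 2 - _).
  by rewrite sE; ring.
have sn : (s <= n)%N by clear -sE aW a'W n_big; nia.
(* After the shift by [s], only the last [s] terms for [x] and the first [s] terms for [x'] remain
   unmatched; the window hypotheses make their valuations 0. *)
rewrite /val_sum (big_cat_nat (n := n - s) (leq0n _) (leq_subr _ _)) /=.
rewrite [RHS](big_cat_nat (n := s) (leq0n _) sn) /=.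
rewrite [X in (_ + X)%N]big1_seq ?addn0; last first.
  move=> k; rewrite andTb mem_index_iota => /andP [h1 h2].
  apply/eqP; rewrite -leqn0 leqNgt; apply/negP => h.
  have kn : (0 < k.+1 <= n)%N by [].
  have := Hx _ kn h; clear -h1 h2 sE aW a'W; lia.
rewrite [X in _ = (X + _)%N]big1_seq ?add0n; last first.
  move=> k; rewrite andTb mem_index_iota => /andP [h1 h2].
  apply/eqP; rewrite -leqn0 leqNgt; apply/negP => h.
  have kn : (0 < k.+1 <= n)%N by clear -h2 sn; lia.
  have := Hx' _ kn h; clear -h1 h2 sE aW a'W; lia.
rewrite -{2}[s]add0n big_addn; apply: eq_bigr => k _.
by rewrite -shift; congr (logn p `|qval x' _|); lia.
Qed.

End Window.

Lemma perm_eq_count (T : eqType) (s1 s2 : seq T) :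
  {in s1 ++ s2, forall x, count_mem x s1 = count_mem x s2} -> perm_eq s1 s2.
Proof. by move=> H; apply/allP => x /H /= ->. Qed.

Lemma count_mem_filter (T : eqType) (a : pred T) (s : seq T) x :
  count_mem x (filter a s) = if a x then count_mem x s else 0%N.
Proof.
rewrite count_filter; case: ifP => ax.
  by apply: eq_count => z /=; case: eqP => // ->; rewrite ax.
by rewrite -(count_pred0 s); apply: eq_count => z /=; case: eqP => // ->; rewrite ax.
Qed.

(** The entries of nonzero weight other than [x0] form the same multiset on both sides and cancel,
    leaving the multiplicity of [x0] times its weight. *)
Lemma sum_count_eq (T : eqType) (V : T -> nat) (s1 s2 : seq T) (x0 : T) :
  {in s1 ++ s2, forall x, x != x0 -> V x != 0%N -> count_mem x s1 = count_mem x s2} ->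
  (\sum_(x <- s1) V x = \sum_(x <- s2) V x)%N -> (0 < V x0)%N ->
  count_mem x0 s1 = count_mem x0 s2.
Proof.
move=> H E V0.
have split s : (\sum_(x <- s) V x = count_mem x0 s * V x0 +
    \sum_(x <- filter (fun x => (x != x0) && (V x != 0)) s) V x)%N.
  rewrite (bigID (fun x => x == x0)) /=; congr addn.
    rewrite -sum1_count big_distrl /=.
    by apply: eq_bigr => x /eqP ->; rewrite mul1n.
  rewrite big_filter [LHS]big_mkcond [RHS]big_mkcond; apply: eq_bigr => x _ /=.
  by case: eqP => //= _; case: eqP.
have P : perm_eq (filter (fun x => (x != x0) && (V x != 0)%N) s1)
                 (filter (fun x => (x != x0) && (V x != 0)%N) s2).
  apply: perm_eq_count => x; rewrite -filter_cat mem_filter !count_mem_filter.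
  by case/andP => /andP [n0 v0] xs; rewrite n0 v0 /=; apply: H.
move: E; rewrite (split s1) (split s2) (perm_big _ P) /= => /addIn /eqP.
by rewrite eqn_pmul2r // => /eqP.
Qed.

Lemma min_count_neq (s1 s2 : seq int) : size s1 = size s2 -> ~~ perm_eq s1 s2 ->
  exists D0, [/\ D0 != 0, count_mem D0 s1 != count_mem D0 s2 &
    forall D, D != 0 -> count_mem D s1 != count_mem D s2 -> (`|D0| <= `|D|)%N].
Proof.
move=> sz np.
pose bad D := (D != 0) && (count_mem D s1 != count_mem D s2).
have bad_mem D : bad D -> D \in s1 ++ s2.
  case/andP => _; apply: contraNT; rewrite mem_cat negb_or => /andP [h1 h2].
  by rewrite !(count_memPn _).
have [Hbad|Hbad] := boolP (has bad (s1 ++ s2)); last first.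
  case/negP: np; apply: perm_eq_count.
  have Hn D : D != 0 -> count_mem D s1 = count_mem D s2.
    move=> D0; apply/eqP; apply/negPn/negP => ne.
    have bD : bad D by rewrite /bad D0.
    by case/hasP: Hbad; exists D => //; apply: bad_mem.
  have P : perm_eq (filter (fun x => x != 0) s1) (filter (fun x => x != 0) s2).
    apply: perm_eq_count => D; rewrite -filter_cat mem_filter !count_mem_filter.
    by case/andP => D0 _; rewrite D0 Hn.
  (* Equal sizes exclude a discrepancy at 0 alone. *)
  move=> D _; have [->|/Hn//] := eqVneq D 0.
  have e (s : seq int) : (count_mem (0 : int) s + count (fun x : int => x != 0) s = size s)%N.
    exact: count_predC.
  have e2 := perm_size P; rewrite !size_filter in e2.
  by apply/eqP; rewrite -(eqn_add2r (count (fun x : int => x != 0) s1)) e e2 e sz.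
have ex : exists m, has (fun D => (`|D|%N == m) && bad D) (s1 ++ s2).
  by case/hasP: Hbad => D Ds bD; exists `|D|%N; apply/hasP; exists D; rewrite ?eqxx.
case: (ex_minnP ex) => m /hasP [D0 _ /andP [/eqP <- /andP [h1 h2]]] mmin.
exists D0; split=> // D Dn0 Dc; apply: mmin; apply/hasP.
have bD : bad D by rewrite /bad Dn0.
by exists D; rewrite ?eqxx //; apply: bad_mem.
Qed.

Lemma logn_prodn (I : Type) (r : seq I) (F : I -> nat) p :
  all (fun i => 0 < F i)%N r -> logn p (\prod_(i <- r) F i) = (\sum_(i <- r) logn p (F i))%N.
Proof.
move=> F0.
suff [] : (0 < \prod_(i <- r) F i)%N /\ logn p (\prod_(i <- r) F i) = (\sum_(i <- r) logn p (F i))%N by [].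
elim: r F0 => [_|i r IH /= /andP [i0 /IH [h1 h2]]]; first by rewrite !big_nil logn1.
by rewrite !big_cons muln_gt0 i0 h1 lognM // h2.
Qed.

(** If the multisets differed, a large prime attached to the least differing discriminant [D0] would
    have different valuations on the two sides of the equation. *)
Lemma disc_perm_eq (R : realType) (LF LG : seq (int * int)) (T1 T2 : int) (W n : nat) :
  size LF = size LG ->
  {in LF ++ LG, forall x, [/\ `|x.1| <= W, `|x.2| <= W & `|disc x| <= W]%N} ->
  {in LF ++ LG, forall x, disc x != 0 ->
     forall u v : int, u ^+ 2 = disc x * v ^+ 2 -> u = 0 /\ v = 0} ->
  {in LF ++ LG &, forall x x', exists w : int, disc x * disc x' = w ^+ 2} ->
  {in LF ++ LG, forall x (k : nat), (0 < k)%N -> qval x k%:Z != 0} ->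
  T1 != 0 -> T2 != 0 -> (`|T1| <= W)%N -> (`|T2| <= W)%N ->
  (2 ^ (2 * 3001 * W ^ 2) <= n)%N ->
  T1 * \prod_(x <- LG) \prod_(0 <= k < n) qval x k.+1%:Z =
  T2 * \prod_(x <- LF) \prod_(0 <= k < n) qval x k.+1%:Z ->
  perm_eq (map disc LF) (map disc LG).
Proof.
move=> sz bnd nsq sqr q0 T10 T20 T1W T2W nW E.
apply/negPn/negP => np.
have [|D0 [D0n0 D0c D0min]] := min_count_neq _ np; first by rewrite !size_map.
have n_big : (2 * 3001 * W ^ 2 < n)%N by apply: leq_trans nW; apply: ltn_expl.
have : D0 \in map disc (LF ++ LG).
  apply: contraNT D0c; rewrite map_cat mem_cat negb_or => /andP [h1 h2].
  by rewrite !(count_memPn _).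
case/mapP => x0 x0L D0E.
have [a0W c0W D0W] := bnd _ x0L; rewrite -D0E in D0W.
have W0 : (0 < W)%N by rewrite (leq_trans _ D0W) // absz_gt0.
have D0nsq : forall u v : int, u ^+ 2 = D0 * v ^+ 2 -> u = 0 /\ v = 0.
  by rewrite D0E; apply: nsq => //; rewrite -D0E.
have [p [k0 [pp pbig k0lo k0hi pk0]]] := large_prime_divisor R D0E D0nsq a0W c0W D0W nW.
set N := (n %/ _)%N in k0lo.
have N_small : (N * (4 * `|D0|.+1) <= n)%N by apply: leq_trunc_div.
have n12 : (12 * (W * W) < n)%N.
  by apply: leq_ltn_trans n_big; rewrite mulnn leq_mul2r orbT.
clearbody N; clear n_big.
pose a0 : int := x0.1; have a0W' : (`|a0| <= W)%N by [].
pose y := 2 * k0%:Z - a0.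
have y_root : (p %| y ^+ 2 - D0)%Z by rewrite D0E -qval_disc dvdz_mull // dvdzE.
have y_ge : 2 * n%:Z <= y + 2 * N%:Z + 5 * W%:Z.
  by rewrite /y; clear -k0lo a0W'; lia.
have y_le : y <= 2 * n%:Z - 2 * W%:Z by rewrite /y; clear -k0hi a0W'; lia.
pose L := LF ++ LG.
have window x k : x \in L -> (0 < k <= n)%N -> (0 < logn p `|qval x k%:Z|)%N ->
  [/\ disc x != 0, (`|disc x| <= `|D0|)%N, W%:Z < 2 * k%:Z - x.1 & 2 * k%:Z - x.1 <= 2 * n%:Z - 2 * W%:Z].
  move=> xL kn lp; have [aW cW DW] := bnd _ xL.
  have qn0 : qval x k%:Z != 0.
    by apply: contraTneq lp => ->; rewrite logn0.
  have pq : (p %| qval x k%:Z)%Z.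
    by rewrite dvdzE -[p]expn1 pfactor_dvdn // absz_gt0.
  have [w0 wE] := sqr _ _ xL x0L; rewrite -D0E in wE.
  apply: (root_in_window (w := `|w0|) pp pbig y_root D0n0 D0W n12 N_small y_ge y_le) => //.
  by rewrite wE real_normK ?num_real.
(* By [val_sum_shift] the valuation depends on the discriminant alone, so the first representative
   in [L] can define it. *)
pose V D := val_sum n p (nth (0, 0) L (index D (map disc L))).
have VE x : x \in L -> val_sum n p x = V (disc x).
  move=> xL; have dL : disc x \in map disc L by apply: map_f.
  have iL : (index (disc x) (map disc L) < size L)%N by rewrite -(size_map disc) index_mem.
  have x'L := mem_nth (0, 0) iL.
  rewrite /V; set x' := nth _ _ _ in x'L *.
  have x'D : disc x = disc x'.
    by rewrite -(nth_map (0, 0) 0 disc iL) nth_index.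
  have [aW _ _] := bnd _ xL; have [a'W _ _] := bnd _ x'L.
  apply: (val_sum_shift (W := W) n12) => // k kn lp.
    by have [] := window _ _ xL kn lp.
  by have [] := window _ _ x'L kn lp.
have V0 D : D \in map disc L -> V D != 0%N -> D != 0 /\ (`|D| <= `|D0|)%N.
  case/mapP => x xL ->; rewrite -VE // /val_sum => h.
  have [/hasP [k]|/hasPn nk] := boolP (has (fun k => 0 < logn p `|qval x k.+1%:Z|)%N (index_iota 0 n)).
    by rewrite mem_index_iota => kn lp; have [] := window _ k.+1 xL kn lp.
  case/negP: h; rewrite big1_seq // => k /andP [_ /nk].
  by rewrite lt0n negbK => /eqP.
have k0n : (0 < k0 <= n)%N.
  apply/andP; split; last by clear -k0hi; lia.
  have N8 : (8 * N <= n)%N.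
    apply: leq_trans N_small; rewrite mulnC leq_mul2l.
    by have : (0 < `|D0|)%N; [rewrite absz_gt0|clear; lia].
  have WW : (W <= W * W)%N by rewrite leq_pmull.
  by clear -k0lo n12 N8 WW; lia.
have VD0 : (0 < V D0)%N.
  rewrite D0E -VE // /val_sum (big_cat_nat (n := k0.-1)) //=; last by clear -k0n; lia.
  rewrite (big_ltn (m := k0.-1)); last by clear -k0n; lia.
  rewrite prednK; last by case/andP: k0n.
  rewrite addn_gt0; apply/orP; right; rewrite addn_gt0; apply/orP; left.
  by rewrite -pfactor_dvdn ?expn1 // absz_gt0 q0 //; case/andP: k0n.
have val (T : int) (L' : seq (int * int)) : {subset L' <= L} -> T != 0 -> (`|T| <= W)%N ->
   logn p `|(T * \prod_(x <- L') \prod_(0 <= k < n) qval x k.+1%:Z)%R| = (\sum_(D <- map disc L') V D)%N.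
  move=> sub T0 TW; rewrite abszM (big_morph absz abszM (erefl _)).
  have q0' x : x \in L' -> (0 < `|(\prod_(0 <= k < n) qval x k.+1%:Z)%R|)%N.
    move=> xL; rewrite absz_gt0 prodf_seq_neq0; apply/allP => k _ /=.
    by apply: q0 => //; apply: sub.
  rewrite lognM ?absz_gt0 //; last first.
    by rewrite big_seq prodn_cond_gt0.
  (* The prime exceeds [W], hence [|T|]. *)
  have -> : logn p `|T| = 0%N.
    apply/eqP; rewrite -leqn0 leqNgt -pfactor_dvdn ?absz_gt0 // expn1; apply/negP => /dvdn_leq.
    rewrite absz_gt0 T0 => /(_ isT) h.
    have : (W <= 6 * W * n)%N by rewrite mulnAC leq_pmull // muln_gt0; clear -n12; lia.
    by clear -h TW pbig; lia.
  rewrite add0n logn_prodn; last by apply/allP => x /q0'.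
  rewrite big_map big_seq [RHS]big_seq; apply: eq_bigr => x xL.
  rewrite -VE ?sub // /val_sum (big_morph absz abszM (erefl _)) logn_prodn //.
  by apply/allP => k _; rewrite absz_gt0 q0 // sub.
have subG : {subset LG <= L} by move=> x; rewrite mem_cat orbC => ->.
have subF : {subset LF <= L} by move=> x; rewrite mem_cat => ->.
have EV : (\sum_(D <- map disc LF) V D = \sum_(D <- map disc LG) V D)%N.
  by rewrite -(val T2) // -(val T1) // E.
(* A discriminant [D] of nonzero weight with differing multiplicities has [|D| = |D0|] by
   minimality; since [D * D0] is a square the signs agree, so [D = D0]. *)
case/negP: D0c; apply/eqP; apply: sum_count_eq EV VD0 => D.
rewrite -map_cat => DL DD0 /(V0 _ DL) [Dn0 le]; apply/eqP; apply/negPn/negP => c.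
have := D0min _ Dn0 c => le'.
case/mapP: DL => x xL DE.
have [w wE] := sqr _ _ xL x0L; rewrite -D0E -DE in wE.
case/negP: DD0.
have : 0 <= D * D0 by rewrite wE sqr_ge0.
have eq : `|D|%N = `|D0|%N by apply/eqP; rewrite eqn_leq le.
clear -eq Dn0 D0n0 => h; have [d1|d1] := lerP 0 D; have [d2|d2] := lerP 0 D0.
- by apply/eqP; lia.
- by have := nmulr_llt0 D d2; move: h; rewrite leNgt => /negP; lia.
- by have := nmulr_rlt0 D0 d1; move: h; rewrite leNgt => /negP; lia.
- by apply/eqP; lia.
Qed.

(** * Factorization over a quadratic field *)

Lemma rat_sqr_int (s : rat) (D : int) : s ^+ 2 = D%:~R -> exists w : int, D = w ^+ 2.
Proof.
move=> E.
have d0 := denq_neq0 s.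
have E' : numq s ^+ 2 = D * denq s ^+ 2.
  apply/eqP; rewrite -(eqr_int rat) [X in _ == X]rmorphM !rmorphXn /= -E.
  by rewrite -{2}(divq_num_den s) expr_div_n divfK // expf_neq0 // intr_eq0.
suff d1 : denq s = 1 by exists (numq s); rewrite E' d1 expr1n mulr1.
have : (denq s %| numq s ^+ 2)%Z by rewrite E' expr2 mulrA dvdz_mull.
have cop : coprimez (denq s) (numq s) by rewrite coprimez_sym /coprimez; exact: coprime_num_den.
rewrite expr2 Gauss_dvdzr // -[numq s]mulr1 Gauss_dvdzr // dvdz1 => h.
by have := denq_gt0 s; lia.
Qed.

Section QuadraticField.
Variable K : fieldExtType rat.
Hypothesis dimK : \dim {: K} = 2%N.

Definition irrational (z : K) := forall q : rat, z <> q%:A.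

Lemma irrational_basis (d z : K) : irrational d -> exists u v : rat, z = u%:A + v *: d.
Proof.
move=> irr.
have fr : free [tuple d; 1].
  rewrite free_cons seq1_free oner_eq0 andbT span_seq1.
  by apply/negP => /vlineP [q /irr].
have bs : basis_of {:K} [tuple d; 1] by rewrite basisEfree fr subvf dimK.
exists (coord [tuple d; 1] ord_max z), (coord [tuple d; 1] ord0 z).
rewrite [LHS](coord_basis bs (memvf z)) !big_ord_recl big_ord0 addr0 addrC.
by congr (coord _ _ _ *: _ + _); apply: val_inj.
Qed.

Lemma alg_int (D : int) : (D%:~R)%:A = D%:~R :> K.
Proof. exact: (rmorph_int (in_alg K)). Qed.

Lemma algX (q : rat) n : q%:A ^+ n = (q ^+ n)%:A :> K.
Proof. exact: (esym (rmorphXn (in_alg K) n q)). Qed.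

Lemma algM (a b : rat) : (a * b)%:A = a%:A * b%:A :> K.
Proof. exact: (rmorphM (in_alg K)). Qed.

Lemma algD (a b : rat) : (a + b)%:A = a%:A + b%:A :> K.
Proof. exact: (rmorphD (in_alg K)). Qed.

Lemma alg_nat (n : nat) : (n%:R : rat)%:A = n%:R :> K.
Proof. exact: (rmorph_nat (in_alg K)). Qed.

Lemma algB (a b : rat) : (a - b)%:A = a%:A - b%:A :> K.
Proof. exact: (rmorphB (in_alg K)). Qed.

Lemma irrational_nsq (d : K) (D : int) : irrational d -> d ^+ 2 = D%:~R ->
  forall u v : int, u ^+ 2 = D * v ^+ 2 -> u = 0 /\ v = 0.
Proof.
move=> irr dE u v E; have [v0|v0] := eqVneq v 0.
  by split=> //; move: E; rewrite v0 expr0n mulr0 => /eqP; rewrite sqrf_eq0 => /eqP.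
exfalso; pose s : rat := u%:~R / v%:~R.
have sE : s ^+ 2 = D%:~R.
  by rewrite expr_div_n -!rmorphXn /= E rmorphM mulfK // intr_eq0 expf_neq0.
have : d ^+ 2 == (s%:A) ^+ 2 by rewrite dE algX sE alg_int.
by rewrite eqf_sqr => /orP [/eqP/irr //|/eqP]; rewrite -scaleNr => /irr.
Qed.

(** The value 0 comes from the square of a rational linear factor; any other discriminant has an
    irrational square root in [K]. *)
Definition quadratic_disc (D : int) : Prop :=
  D = 0 \/ exists2 d : K, irrational d & d ^+ 2 = D%:~R.

(** Write [d' = u + v * d]. As [d' ^ 2] is rational and [d] is not, [u * v = 0], and [v = 0] would
    make [d'] rational. So [d' = v * d] and [D * D' = (v * D) ^ 2]. *)
Lemma quadratic_disc_sqr (D D' : int) : quadratic_disc D -> quadratic_disc D' ->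
  exists w : int, D * D' = w ^+ 2.
Proof.
case=> [->|[d irr dE]]; first by exists 0; rewrite mul0r expr0n.
case=> [->|[d' irr' d'E]]; first by exists 0; rewrite mulr0 expr0n.
have [u [v E]] := irrational_basis d' irr.
have E2 : (2 * u * v) *: d = (D'%:~R - u ^+ 2 - v ^+ 2 * D%:~R)%:A.
  rewrite -[LHS]mulr_algl !algB !algM !alg_int -dE -d'E E -[v *: d]mulr_algl.
  by rewrite (alg_nat 2); ring.
have uv : u = 0 \/ v = 0.
  have [h|h] := eqVneq (2 * u * v) 0.
    move/eqP: h; rewrite !mulf_eq0 => /orP [/orP [//|/eqP ->]|/eqP ->]; [by left|by right].
  exfalso; apply: (irr ((2 * u * v)^-1 * (D'%:~R - u ^+ 2 - v ^+ 2 * D%:~R))).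
  by rewrite -scalerA -E2 scalerA mulVf // scale1r.
case: uv => h0; last by case: (irr' u); rewrite E h0 scale0r addr0.
apply: (@rat_sqr_int (v * D%:~R)).
apply: (fmorph_inj (in_alg K)).
rewrite /= -algX algM !alg_int intrM -dE -d'E E h0 scale0r add0r -[v *: d]mulr_algl.
by ring.
Qed.

End QuadraticField.

Definition Qpoly (x : int * int) : {poly int} := 'X^2 - x.1 *: 'X + x.2%:P.

Lemma horner_Qpoly x k : (Qpoly x).[k] = qval x k.
Proof. by rewrite /Qpoly /qval /quad !hornerE. Qed.

Local Notation pZtoQ := (map_poly (intr : int -> rat)).

(** Gauss's lemma. The integer factors have a common leading coefficient [e], equal to 1 or -1, and
    multiplying both by [e] makes them monic. *)
Lemma monic_rat_factor (f : {poly int}) (m : {poly rat}) :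
  f \is monic -> m \is monic -> m %| pZtoQ f ->
  exists q r, [/\ f = q * r, q \is monic, r \is monic & pZtoQ q = m].
Proof.
move=> /monicP fm /monicP mm /dvdpP_rat_int [q [a a0 mE] [r fE]].
have lqr : lead_coef q * lead_coef r = 1 by rewrite -lead_coefM -fE.
set e := lead_coef q in lqr.
have ee : e * e = 1.
  have : (`|e| * `|lead_coef r| = 1)%N by rewrite -abszM lqr.
  by move/eqP; rewrite muln_eq1 => /andP [/eqP h _]; lia.
have re : lead_coef r = e by rewrite -[LHS]mul1r -ee -mulrA lqr mulr1.
have ae : a = e%:~R.
  have : a * e%:~R = 1.
    transitivity (lead_coef m); last exact: mm.
    by rewrite mE lead_coefZ lead_coef_map_inj ?rmorph0 // => y z /intr_inj.
  by move=> h; rewrite -[LHS]mulr1 -[1](_ : e%:~R * e%:~R = 1) ?mulrA ?h ?mul1r // -rmorphM ee.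
exists (e *: q), (e *: r); split.
- by rewrite -scalerAl -scalerAr scalerA ee scale1r.
- by apply/monicP; rewrite lead_coefZ.
- by apply/monicP; rewrite lead_coefZ re.
- by rewrite mE ae map_polyZ.
Qed.

Section Factor.
Variable K : fieldExtType rat.
Hypothesis dimK : \dim {: K} = 2%N.

Local Notation pZtoK := (map_poly (fun z : int => z%:~R : K)).
Local Notation pQtoK := (map_poly (in_alg K)).

Lemma pZtoKE p : pZtoK p = pQtoK (pZtoQ p).
Proof. by rewrite -map_poly_comp; apply: eq_map_poly => z /=; rewrite alg_int. Qed.

Lemma coef_pZtoQ q m i : pZtoQ q = m -> (q`_i)%:~R = m`_i.
Proof. by move=> <-; rewrite coef_map. Qed.

Lemma rational_factor (f : {poly int}) (s : rat) :
  f \is monic -> root (pZtoK f) s%:A ->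
  exists q r, [/\ f = q * r, q \is monic, r \is monic, (1 < size q)%N &
    exists2 x, q ^+ 2 = Qpoly x & disc x = 0].
Proof.
move=> fm; rewrite pZtoKE (fmorph_root (in_alg K)) -dvdp_XsubCl => /(monic_rat_factor fm (monicXsubC s)).
case=> q [r [fE qm rm qE]].
have sq : size q = 2%N by rewrite -size_rat_int_poly qE size_XsubC.
exists q, r; split=> //; first by rewrite sq.
have q1 : q`_1 = 1 by move/monicP: qm; rewrite lead_coefE sq.
have {}qE : q = 'X + (q`_0)%:P.
  apply/polyP => -[|[|i]]; rewrite coefD coefX coefC /= ?add0r ?addr0 //.
  by rewrite nth_default ?sq.
exists (- (2 * q`_0), q`_0 ^+ 2); last by rewrite /disc /=; ring.
rewrite {1}qE /Qpoly /= -mul_polyC polyCN polyCM polyC_exp (polyC_natr _ 2).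
by ring.
Qed.

(** The relation [r ^ 2 = u + v * r] gives a monic quadratic [m] over the rationals. The remainder
    of [f] modulo [m] is at most linear and vanishes at the irrational [r], so it is 0. *)
Lemma irrational_factor (f : {poly int}) (r : K) :
  f \is monic -> irrational r -> root (pZtoK f) r ->
  exists q g, [/\ f = q * g, q \is monic, g \is monic, (1 < size q)%N &
    exists2 x, q = Qpoly x & quadratic_disc K (disc x)].
Proof.
move=> fm irr; rewrite pZtoKE => rf.
have [u [v rE]] := irrational_basis dimK (r ^+ 2) irr.
pose m : {poly rat} := 'X^2 - (v *: 'X + u%:P).
have sl : (size (v *: 'X + u%:P)%R < size ('X^2 : {poly rat}))%N.
  rewrite size_polyXn ltnS (leq_trans (size_polyD _ _)) // geq_max.
  rewrite (leq_trans (size_scale_leq _ _)) ?size_polyX //=.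
  by rewrite (leq_trans (size_polyC_leq1 _)).
have sm : size m = 3%N by rewrite /m size_polyDl ?size_polyN // size_polyXn.
have mm : m \is monic.
  by apply/monicP; rewrite /m lead_coefDl ?size_polyN // lead_coefXn.
have mr : (pQtoK m).[r] = 0.
  rewrite /m !(rmorphB, rmorphD) /= map_polyZ map_polyC map_polyX !rmorphXn /= map_polyX.
  by rewrite !hornerE /= rE mulr_algl; ring.
have mf : m %| pZtoQ f.
  rewrite /dvdp.
  set rem := pZtoQ f %% m.
  have srem : (size rem <= 2)%N by rewrite -ltnS -sm ltn_modp monic_neq0.
  have remE : rem = rem`_1 *: 'X + (rem`_0)%:P.
    apply/polyP => -[|[|i]]; rewrite coefD coefZ coefX coefC /= ?mulr0 ?mulr1 ?add0r ?addr0 //.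
    by rewrite nth_default // (leq_trans srem).
  have : (pQtoK (pZtoQ f)).[r] = 0 by apply/eqP.
  rewrite (divp_eq (pZtoQ f) m) rmorphD rmorphM /= hornerD hornerM mr mulr0 add0r -/rem remE.
  rewrite rmorphD /= map_polyZ map_polyC map_polyX !hornerE /= => h.
  have h1 : rem`_1 = 0.
    apply/eqP/negPn/negP => n0; apply: (irr (- (rem`_1)^-1 * rem`_0)).
    have /eqP := h; rewrite addr_eq0 mulr_algl => /eqP h'.
    rewrite mulNr scaleNr -scalerA -[LHS]scale1r -(mulVf n0) -scalerA h'.
    by rewrite scalerN.
  move/eqP: h; rewrite h1 scale0r mul0r add0r scaler_eq0 oner_eq0 orbF => /eqP h0.
  by rewrite scale0r h0 addr0.
have [q [g [fE qm gm qE]]] := monic_rat_factor fm mm mf.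
have sq : size q = 3%N by rewrite -size_rat_int_poly qE.
have q2 : q`_2 = 1 by move/monicP: qm; rewrite lead_coefE sq.
have qE' : q = Qpoly (- q`_1, q`_0).
  rewrite /Qpoly /=; apply/polyP => -[|[|[|i]]];
    rewrite coefD coefB coefXn coefZ coefX coefC /= ?mulr0 ?mulr1 ?subr0 ?sub0r ?add0r ?addr0 ?opprK //.
  by rewrite nth_default // sq.
exists q, g; split=> //; first by rewrite sq.
exists (- q`_1, q`_0) => //; right.
have vE : (q`_1)%:~R = - v.
  by rewrite (coef_pZtoQ 1 qE) /m coefB coefXn coefD coefZ coefX coefC /= ?mulr1 ?addr0 ?sub0r ?add0r.
have uE : (q`_0)%:~R = - u.
  by rewrite (coef_pZtoQ 0 qE) /m coefB coefXn coefD coefZ coefX coefC /= ?mulr0 ?add0r ?sub0r.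
(* The conjugate of [r] is [v - r], so this is the difference of the two roots, a square root of the
   discriminant. *)
exists (2 * r - v%:A) => [t h|].
  apply: (irr (2^-1 * (t + v))).
  have -> : (2^-1 * (t + v))%:A = (2 : rat)^-1%:A * (t%:A + v%:A) :> K.
    by rewrite algM algD.
  by rewrite -h subrK mulrA -(alg_nat K 2) -algM mulVf // scale1r mul1r.
rewrite -alg_int /disc /= sqrrN rmorphB rmorphXn [X in _ = (_ - X)%:A]rmorphM /= vE uE sqrrN.
have -> : (v ^+ 2 - 4%:~R * - u)%:A = v%:A ^+ 2 + 4 * u%:A :> K.
  by rewrite mulrN opprK algD algX (algM _ 4%:~R) alg_int.
have -> : (2 * r - v%:A) ^+ 2 = 4 * r ^+ 2 - 4 * (v%:A * r) + v%:A ^+ 2 by ring.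
by rewrite rE -[v *: r]mulr_algl; ring.
Qed.

(** Squaring puts all roots on the same footing: a rational root yields one quadratic of
    discriminant 0, an irrational one its minimal polynomial twice. *)
Lemma square_factorization (f : {poly int}) : f \is monic -> splits_over K f ->
  exists2 L : seq (int * int), f ^+ 2 = \prod_(x <- L) Qpoly x &
    {in L, forall x, quadratic_disc K (disc x)}.
Proof.
have [n] := ubnP (size f); elim: n f => // n IH f sf fm [rs fE].
have [s1|s1] := leqP (size f) 1.
  exists [::] => //; rewrite big_nil.
  have := monic_neq0 fm; rewrite -size_poly_gt0 => s0.
  have /size_poly1P [c _ fc] : size f == 1%N by rewrite eqn_leq s1.
  by move/monicP: fm; rewrite fc lead_coefC => ->; rewrite expr1n.
have sK : size (pZtoK f) = size f.
  by rewrite pZtoKE size_map_poly size_rat_int_poly.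
have [r rr] : exists r, root (pZtoK f) r.
  case: rs fE => [|r rs] fE; last first.
    by exists r; rewrite (eqp_root fE) big_cons rootM root_XsubC eqxx.
  by move/eqp_size: fE; rewrite big_nil size_poly1 sK => h; rewrite h in s1.
have step q g : f = q * g -> g \is monic -> (1 < size q)%N -> q \is monic ->
  exists2 L : seq (int * int), g ^+ 2 = \prod_(x <- L) Qpoly x &
    {in L, forall x, quadratic_disc K (disc x)}.
  move=> fqg gm sq qm; apply: IH => //.
    move: sf; rewrite fqg size_monicM ?monic_neq0 //.
    by move: (size q) sq (size g) => a ha b; lia.
  have : pZtoK g %| \prod_(r <- rs) ('X - r%:P).
    rewrite -(eqp_dvdr _ fE) !pZtoKE fqg !rmorphM /=.
    exact: dvdp_mull.
  by case/(dvdp_prod_XsubC (F := id)) => mk h; exists (mask mk rs).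
have [[s rs']|nr] := pselect (exists s : rat, r = s%:A).
  rewrite rs' in rr; have [q [g [fqg qm gm sq [x qx Dx]]]] := rational_factor fm rr.
  have [L gL HL] := step q g fqg gm sq qm.
  exists (x :: L); first by rewrite big_cons -qx -gL -exprMn -fqg.
  by move=> y; rewrite inE => /orP [/eqP ->|/HL //]; left.
have irr : irrational r by move=> s rs'; apply: nr; exists s.
have [q [g [fqg qm gm sq [x qx Dx]]]] := irrational_factor fm irr rr.
have [L gL HL] := step q g fqg gm sq qm.
exists (x :: x :: L); first by rewrite !big_cons -qx -gL fqg mulrA -expr2 -exprMn.
by move=> y; rewrite !inE => /orP [/eqP -> //|/orP [/eqP -> //|/HL //]].
Qed.

End Factor.

(** * Telescoping products *)

Definition qprod (x : int * int) (n : nat) : int := \prod_(0 <= k < n) qval x k.+1%:Z.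

Lemma perm_map_eq (T1 T2 : eqType) (h : T1 -> T2) (s1 s2 : seq T1) :
  perm_eq (map h s1) (map h s2) -> exists2 s, perm_eq s s2 & map h s1 = map h s.
Proof.
case: s2 => [|x0 s2'] E.
  by exists [::] => //; move/perm_size: E => /eqP; rewrite !size_map => /nilP ->.
move: (x0 :: s2') E => s2 /(perm_iotaP (h x0)) [Is pI E].
exists (map (nth x0 s2) Is).
  by apply/(perm_iotaP x0); exists Is => //; rewrite size_map in pI.
rewrite E -map_comp; apply/eq_in_map => i; rewrite (perm_mem pI) mem_iota size_map => h'.
by rewrite /= (nth_map x0).
Qed.

(** Formally the quotient of [qprod x (n + s)] by [qprod x n], as a polynomial in [n]. *)
Definition shifted_prod (x : int * int) (s : nat) : {poly int} :=
  \prod_(0 <= k < s) (Qpoly x \Po ('X + k.+1%:Z%:P)).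

Lemma horner_shifted_prod x s (n : int) :
  (shifted_prod x s).[n] = \prod_(0 <= k < s) qval x (n + k.+1%:Z).
Proof.
by rewrite horner_prod; apply: eq_bigr => k _; rewrite horner_comp horner_Qpoly !hornerE.
Qed.

Lemma size_Qpoly x : size (Qpoly x) = 3%N.
Proof.
have sl : (size (- (x.1 *: 'X) + x.2%:P)%R < size ('X^2 : {poly int}))%N.
  rewrite size_polyXn ltnS (leq_trans (size_polyD _ _)) // geq_max.
  rewrite size_polyN (leq_trans (size_scale_leq _ _)) ?size_polyX //=.
  by rewrite (leq_trans (size_polyC_leq1 _)).
by rewrite /Qpoly -addrA size_polyDl // size_polyXn.
Qed.

Lemma size_shifted_prod x s : (size (shifted_prod x s) <= (2 * s).+1)%N.
Proof.
elim: s => [|s IH]; first by rewrite /shifted_prod big_nil size_poly1.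
rewrite /shifted_prod big_nat_recr //= -/(shifted_prod x s).
apply: leq_trans (size_polyMleq _ _) _.
have -> : size (Qpoly x \Po ('X + s.+1%:Z%:P)) = 3%N.
  by rewrite size_comp_poly2 ?size_Qpoly // size_XaddC.
by move: IH; move: (size _) => m; lia.
Qed.

Lemma qprod_shift (x x' : int * int) (s n : nat) :
  (forall k : int, qval x' (k + s%:Z) = qval x k) ->
  qprod x' n * (shifted_prod x' s).[n%:Z] = qprod x n * qprod x' s.
Proof.
(* The same product is split once after [n] factors and once after [s]. *)
move=> sh; transitivity (qprod x' (n + s)).
  rewrite /qprod (big_cat_nat (n := n) (leq0n _) (leq_addr _ _)) /=; congr (_ * _).
  rewrite horner_shifted_prod -{2}[n]add0n big_addn addKn; apply: eq_bigr => k _.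
  by congr qval; lia.
rewrite addnC /qprod (big_cat_nat (n := s) (leq0n _) (leq_addr _ _)) /= mulrC; congr (_ * _).
rewrite -{1}[s]add0n big_addn addKn; apply: eq_bigr => k _.
by rewrite -sh; congr qval; lia.
Qed.

Definition telescope_bound (W j : nat) : nat := (3 * (j + W).+1 ^ 2) ^ W.

Lemma telescope_bound_gt0 W j : (0 < telescope_bound W j)%N.
Proof. by rewrite /telescope_bound expn_gt0 muln_gt0 expn_gt0. Qed.

Lemma qval_le (x : int * int) (W j k : nat) : (`|x.1| <= W)%N -> (`|x.2| <= W)%N ->
  (k <= j + W)%N -> (`|(qval x k%:Z)%R| <= 3 * (j + W).+1 ^ 2)%N.
Proof.
case: x => a c /= aW cW kj; rewrite /qval /quad /=.
have h1 : (`|(a * k%:Z)%R| <= (j + W).+1 * (j + W).+1)%N.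
  by rewrite abszM; apply: leq_mul; clear -aW kj; lia.
have h2 : (k * k <= (j + W).+1 * (j + W).+1)%N by apply: leq_mul; clear -kj; lia.
have h3 : (`|c| <= (j + W).+1 * (j + W).+1)%N.
  apply: (@leq_trans (j + W).+1); first by clear -cW; lia.
  exact: leq_pmull.
have h4 : `|(k%:Z ^+ 2)%R|%N = (k * k)%N by rewrite abszX mulnn.
by rewrite -mulnn; move: (_ * _)%N h1 h2 h3 => m; clear -h4; lia.
Qed.

Lemma abs_prod_nat_le (F : nat -> int) (C s W : nat) :
  (forall k, (k < s)%N -> (`|(F k)%R| <= C)%N) -> (0 < C)%N -> (s <= W)%N ->
  (`|(\prod_(0 <= k < s) F k)%R| <= C ^ W)%N.
Proof.
move=> H C0 sW; apply: (@leq_trans (C ^ s)%N); last by rewrite leq_pexp2l.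
elim: s H {sW} => [|s IH] H; first by rewrite big_nil.
rewrite big_nat_recr //= abszM expnSr leq_mul // ?H // IH // => k ks.
by apply: H; apply: ltnW.
Qed.

(** The quadratics are shifts of each other by some [s <= W]; by [qprod_shift] one polynomial is
    [shifted_prod x' s] and the other the constant [qprod x' s]. *)
Lemma telescope_pair (x x' : int * int) (W : nat) :
  disc x = disc x' -> (`|x.1| <= W)%N -> (`|x'.1| <= W)%N ->
  (`|x.2| <= W)%N -> (`|x'.2| <= W)%N ->
  (forall k : nat, (0 < k)%N -> qval x k%:Z != 0) ->
  (forall k : nat, (0 < k)%N -> qval x' k%:Z != 0) ->
  exists A B : {poly int}, [/\ (size A <= (2 * W).+1)%N, (size B <= (2 * W).+1)%N,
   forall n : nat, A.[n%:Z] != 0 /\ B.[n%:Z] != 0,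
   forall n : nat, qprod x' n * A.[n%:Z] = qprod x n * B.[n%:Z] &
   forall j : nat, (`|A.[j%:Z]%R| <= telescope_bound W j)%N /\ (`|B.[j%:Z]%R| <= telescope_bound W j)%N].
Proof.
wlog le : x x' / x.1 <= x'.1.
  move=> H; have [/H//|/ltW /H h] := lerP x.1 x'.1.
  move=> h1 h2 h3 h4 h5 h6 h7; have [A [B [e1 e2 e3 e4 e5]]] := h (esym h1) h3 h2 h5 h4 h7 h6.
  exists B, A; split=> // n; try by rewrite -e4.
    by have [] := e3 n.
  by have [] := e5 n.
move=> eD aW a'W cW c'W q0 q'0.
have [s sE] := disc_shift eD le.
have shift k : qval x' (k + s%:Z) = qval x k.
  apply: (mulfI (isT : (4 : int) != 0)); rewrite !qval_disc eD; congr (_ ^+ 2 - _).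
  by rewrite sE; ring.
have sW : (s <= W)%N by clear -sE aW a'W; lia.
have bnd (j k : nat) : (k < s)%N -> (`|(qval x' (j%:Z + k.+1%:Z))%R| <= 3 * (j + W).+1 ^ 2)%N.
  by move=> ks; rewrite -PoszD; apply: qval_le => //; clear -ks sW; lia.
exists (shifted_prod x' s), (qprod x' s)%:P; split.
- by apply: leq_trans (size_shifted_prod _ _) _; rewrite ltnS leq_mul2l.
- by apply: leq_trans (size_polyC_leq1 _) _.
- move=> n; rewrite hornerC horner_shifted_prod; split.
    by rewrite prodf_seq_neq0; apply/allP => k _; rewrite -PoszD q'0 // addnS.
  by rewrite prodf_seq_neq0; apply/allP => k _; rewrite q'0.
- by move=> n; rewrite hornerC; apply: qprod_shift.
- move=> j; rewrite hornerC horner_shifted_prod; split.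
    by apply: abs_prod_nat_le => // k; apply: bnd.
  apply: abs_prod_nat_le => // k ks; apply: qval_le => //; clear -ks sW; lia.
Qed.

Lemma telescope_seq (LF LG : seq (int * int)) (W : nat) :
  map disc LF = map disc LG ->
  {in LF ++ LG, forall x, (`|x.1| <= W)%N /\ (`|x.2| <= W)%N} ->
  {in LF ++ LG, forall x (k : nat), (0 < k)%N -> qval x k%:Z != 0} ->
  exists A B : {poly int}, [/\ (size A <= (2 * W * size LF).+1)%N /\ (size B <= (2 * W * size LF).+1)%N,
   forall n : nat, A.[n%:Z] != 0 /\ B.[n%:Z] != 0,
   forall n : nat, (\prod_(x <- LG) qprod x n) * A.[n%:Z] = (\prod_(x <- LF) qprod x n) * B.[n%:Z] &
   forall j : nat, (`|A.[j%:Z]%R| <= telescope_bound W j ^ size LF)%N /\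
     (`|B.[j%:Z]%R| <= telescope_bound W j ^ size LF)%N].
Proof.
elim: LF LG => [|x LF IH] [|x' LG] //=.
  exists 1, 1; split=> [|n|n|j].
  - by rewrite size_poly1.
  - by rewrite hornerC.
  - by rewrite !big_nil.
  - by rewrite hornerC.
move=> [eD ED] bnd q0.
have sub : {subset LF ++ LG <= x :: LF ++ x' :: LG}.
  by move=> z; rewrite !(inE, mem_cat) => /orP [->|->]; rewrite ?orbT.
have [A [B [[sA sB] AB0 AB AbsAB]]] := IH LG ED (fun z zL => bnd z (sub z zL)) (fun z zL => q0 z (sub z zL)).
have xL : x \in x :: LF ++ x' :: LG by rewrite inE eqxx.
have x'L : x' \in x :: LF ++ x' :: LG by rewrite inE mem_cat inE eqxx !orbT.
have [b1 b2] := bnd _ xL; have [b3 b4] := bnd _ x'L.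
have [A' [B' [sA' sB' AB0' AB' AbsAB']]] := telescope_pair eD b1 b3 b2 b4 (q0 _ xL) (q0 _ x'L).
have szM (p q : {poly int}) m : (size p <= (2 * W).+1)%N -> (size q <= m.+1)%N -> (size (p * q)%R <= (2 * W + m).+1)%N.
  move=> h1 h2; apply: leq_trans (size_polyMleq _ _) _.
  by move: (size p) (size q) h1 h2 => a b; lia.
exists (A' * A), (B' * B); split=> [|n|n|j].
- by rewrite mulnS !szM.
- by rewrite !hornerM !mulf_neq0 //; have [] := AB0 n; have [] := AB0' n.
- rewrite !big_cons !hornerM mulrACA AB' AB; ring.
- have [h1 h2] := AbsAB j; have [h3 h4] := AbsAB' j.
  by rewrite !hornerM !abszM expnS !leq_mul.
Qed.

(** * Integer roots of integer polynomials *)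

Lemma dvdz_horner_sub (P : {poly int}) (x y : int) : (x - y %| P.[x] - P.[y])%Z.
Proof.
have : root (P - P.[y]%:P) y by rewrite /root !hornerE subrr.
case/factor_theorem => Q /(congr1 (fun p => p.[x])); rewrite !hornerE => ->.
exact: dvdz_mull.
Qed.

Lemma exists_nonroot (P : {poly int}) : P != 0 -> exists2 j : nat, (j < size P)%N & P.[j%:Z] != 0.
Proof.
move=> P0; have [/existsP [j j0]|/existsPn H] := boolP [exists j : 'I_(size P), P.[j%:Z] != 0].
  by exists j.
have u : uniq (map Posz (iota 0 (size P))).
  by rewrite map_inj_uniq ?iota_uniq // => a b [].
have r : all (root P) (map Posz (iota 0 (size P))).
  apply/allP => z /mapP [j]; rewrite mem_iota add0n => jP ->.
  by have := H (Ordinal jP); rewrite negbK.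
by have := max_poly_roots P0 r u; rewrite size_map size_iota ltnn.
Qed.

(** Some [j] below the size of [P] is not a root, and [n - j] divides [P.[j]]. Values at small
    arguments thus suffice and no coefficient has to be estimated. *)
Lemma int_root_bound (P : {poly int}) (n J C : nat) : P != 0 -> P.[n%:Z] = 0 ->
  (size P <= J)%N -> (forall j, (j <= J)%N -> (`|P.[j%:Z]%R| <= C)%N) -> (n <= J + C)%N.
Proof.
move=> P0 Pn sJ H; have [j jP Pj] := exists_nonroot P0.
have [nj|nj] := leqP n J; first by apply: leq_trans (leq_addr _ _).
have := dvdz_horner_sub P n%:Z j%:Z; rewrite Pn sub0r dvdzE abszN.
move=> /dvdn_leq; rewrite absz_gt0 Pj => /(_ isT) h.
have jJ := leq_trans (ltnW jP) sJ.
have := leq_trans h (H j jJ); clear -jJ; lia.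
Qed.

(** * The bound on the index *)

Section Growth.
Local Open Scope nat_scope.

Lemma leq_exp_base (a b e : nat) : a <= b -> a ^ e <= b ^ e.
Proof. by case: e => // e; rewrite leq_exp2r. Qed.

Lemma absz_add_le (u v : int) : `|(u + v)%R| <= `|u| + `|v|.
Proof. lia. Qed.

(** Multiplying by [x] keeps the estimate of the lower terms, each at most [M * x ^ (d - 1)], free
    of division. *)
Lemma monic_approx (p : {poly int}) (M x : nat) : p \is monic -> size p <= M ->
  (forall i, `|(p`_i)%R| <= M) ->
  `|(p.[x%:Z] - x%:Z ^+ (size p).-1)%R| * x <= M * M * x ^ (size p).-1.
Proof.
move=> pm sM coefM; set d := (size p).-1.
have sE : size p = d.+1 by rewrite prednK // size_poly_gt0 monic_neq0.
have [->|x0] := posnP x; first by rewrite muln0.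
have -> : (p.[x%:Z] - x%:Z ^+ d = \sum_(i < d) p`_i * x%:Z ^+ i)%R.
  rewrite horner_coef sE big_ord_recr /=.
  have -> : (p`_d = 1)%R by rewrite -(monicP pm) lead_coefE.
  by rewrite mul1r addrK.
have H m : m <= d -> `|(\sum_(i < m) p`_i * x%:Z ^+ i)%R| * x <= m * (M * x ^ d).
  elim: m => [|m IH] md; first by rewrite big_ord0.
  rewrite big_ord_recr /= mulSn addnC.
  apply: leq_trans (_ : (`|(\sum_(i < m) p`_i * x%:Z ^+ i)%R| + `|(p`_m * x%:Z ^+ m)%R|) * x <= _).
    by rewrite leq_mul2r absz_add_le orbT.
  rewrite mulnDl; apply: leq_add; first exact: IH (ltnW md).
  by rewrite abszM abszX -mulnA -expnSr leq_mul //= leq_pexp2l.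
apply: leq_trans (H d (leqnn _)) _; rewrite mulnA leq_mul2r leq_mul2r.
by apply/orP; right; apply/orP; right; clear -sE sM; lia.
Qed.

Variables (M : nat) (p : {poly int}).
Hypotheses (pm : p \is monic) (sM : size p <= M) (coefM : forall i, `|(p`_i)%R| <= M).

Lemma monic_upper x : 0 < x -> `|(p.[x%:Z])%R| <= (1 + M * M) * x ^ (size p).-1.
Proof.
move=> x0; have := monic_approx x pm sM coefM.
set d := _.-1 => h.
have h1 : `|(p.[x%:Z] - x%:Z ^+ d)%R| <= M * M * x ^ d.
  by apply: leq_trans h; apply: leq_pmulr.
have h2 : `|(x%:Z ^+ d)%R| = x ^ d by rewrite abszX.
have := leq_add h1 (leqnn (x ^ d)); rewrite -{1}h2 mulnDl mul1n addnC [X in _ <= X]addnC.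
by move: (x%:Z ^+ d)%R => X; clear; lia.
Qed.

Lemma monic_lower x : 0 < x -> (x - M * M) * x ^ (size p).-1 <= `|(p.[x%:Z])%R| * x.
Proof.
move=> x0; have := monic_approx x pm sM coefM.
set d := _.-1 => h.
have h2 : `|(x%:Z ^+ d)%R| = x ^ d by rewrite abszX.
rewrite mulnBl leq_subLR -{1}h2 mulnC.
apply: leq_trans (_ : (`|(p.[x%:Z] - x%:Z ^+ d)%R| + `|(p.[x%:Z])%R|) * x <= _).
  by rewrite leq_mul2r; apply/orP; right; move: (x%:Z ^+ d)%R => X; clear; lia.
by rewrite mulnDl leq_add2r.
Qed.

Lemma monic_pos_root x : 0 < x -> (p.[x%:Z] = 0)%R -> x <= M * M.
Proof.
move=> x0 px; have := monic_lower x0; rewrite px mul0n leqn0 muln_eq0 expn_eq0.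
by rewrite (gtn_eqF x0) /= orbF subn_eq0.
Qed.

End Growth.

(** From [k1] on each factor at least doubles the ratio of the products, so [2 ^ (n - k1)] is
    bounded by the data at [k1]. *)
Lemma growth_index (F G : nat -> int) (T1 T2 : int) (k1 n : nat) :
  (forall k, (k1 <= k)%N -> (2 * `|F k| <= `|G k|)%N) ->
  (forall k, F k != 0) -> (forall k, G k != 0) -> T1 != 0 ->
  T1 * \prod_(0 <= k < n) G k = T2 * \prod_(0 <= k < n) F k ->
  (n <= k1 + `|T2| * `|(\prod_(0 <= k < k1) F k)%R|)%N.
Proof.
move=> FG F0 G0 T10 E; have [nk|nk] := leqP n k1.
  by apply: leq_trans nk _; apply: leq_addr.
have le := ltnW nk.
move: E; rewrite (big_cat_nat (leq0n k1) le) [in RHS](big_cat_nat (leq0n k1) le) /=.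
set g1 := \prod_(0 <= k < k1) G k; set f1 := \prod_(0 <= k < k1) F k.
have H m : (2 ^ m * `|(\prod_(k1 <= k < k1 + m) F k)%R| <= `|(\prod_(k1 <= k < k1 + m) G k)%R|)%N.
  elim: m => [|m IH]; first by rewrite addn0 !big_geq.
  rewrite addnS !big_nat_recr ?leq_addr //= !abszM expnSr mulnACA.
  by apply: leq_mul => //; apply: FG; apply: leq_addr.
have {H} := H (n - k1)%N; rewrite subnKC //.
set g2 := \prod_(k1 <= k < n) G k; set f2 := \prod_(k1 <= k < n) F k => H E.
have f20 : (0 < `|f2|)%N by rewrite absz_gt0 prodf_seq_neq0; apply/allP => k _ /=.
have g10 : (0 < `|g1|)%N by rewrite absz_gt0 prodf_seq_neq0; apply/allP => k _ /=.
have : (2 ^ (n - k1) * `|f2| <= `|T2| * `|f1| * `|f2|)%N.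
  apply: leq_trans H _; rewrite -mulnA -!abszM -E !abszM mulnA.
  by rewrite leq_pmull // muln_gt0 absz_gt0 T10.
rewrite leq_pmul2r // => h; have := leq_trans (ltn_expl (n - k1) (isT : (1 < 2)%N)) h.
by clear -le; lia.
Qed.

(** * The explicit bounds *)

Section Bounds.
Local Open Scope nat_scope.

Definition growth_start (M : nat) := 3 * (M * M) + 2.

Definition growth_bound (M : nat) :=
  growth_start M + M * ((1 + M * M) * growth_start M ^ M) ^ growth_start M.

(** For [q = X^2 - a X + c] one has [a = 3 + q(1) - q(2)] and [c = 2 + 2 q(1) - q(2)]; the square
    bounds these two values. *)
Definition coef_bound (M : nat) := 4 + 3 * ((1 + M * M) * 2 ^ M) ^ 2.

(** The last summand covers [T1 ^ 2] and [T2 ^ 2], so that one number bounds all data of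
    [disc_perm_eq]. *)
Definition disc_bound (M : nat) := coef_bound M * coef_bound M + 4 * coef_bound M + M * M.

Definition degree_bound (W : nat) := 2 * W * W + 1.

Definition root_bound (W : nat) :=
  degree_bound W + 2 * (W * telescope_bound W (degree_bound W) ^ W).

Definition index_bound (M : nat) :=
  growth_bound M + 2 ^ (2 * 3001 * disc_bound M ^ 2) + root_bound (disc_bound M).

End Bounds.

Lemma growth_case (f g : {poly int}) (T1 T2 : int) (M n : nat) :
  f \is monic -> g \is monic -> (size f <= M)%N -> (size g <= M)%N ->
  (forall i, (`|(f`_i)%R| <= M)%N) -> (forall i, (`|(g`_i)%R| <= M)%N) ->
  (`|T2| <= M)%N -> T1 != 0 ->
  (forall k : nat, f.[k.+1%:Z] != 0) -> (forall k : nat, g.[k.+1%:Z] != 0) ->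
  (size f < size g)%N ->
  T1 * \prod_(0 <= k < n) g.[k.+1%:Z] = T2 * \prod_(0 <= k < n) f.[k.+1%:Z] ->
  (n <= growth_bound M)%N.
Proof.
move=> fm gm sf sg cf cg T2M T10 f0 g0 fg E.
pose k1 := growth_start M.
have df : (0 < size f)%N by rewrite size_poly_gt0 monic_neq0.
apply: leq_trans (growth_index (k1 := k1) (F := fun k => f.[k.+1%:Z]) (G := fun k => g.[k.+1%:Z]) _ f0 g0 T10 E) _.
  move=> k kk1; have x0 : (0 < k.+1)%N by [].
  have hf := monic_upper fm sf cf x0; have hg := monic_lower gm sg cg x0.
  have xx : (k.+1 ^ (size f).-1 * k.+1 <= k.+1 ^ (size g).-1)%N.
    by rewrite -expnSr leq_pexp2l //; clear -df fg; lia.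
  rewrite -(leq_pmul2r x0).
  apply: leq_trans hg.
  apply: leq_trans (_ : (2 * ((1 + M * M) * k.+1 ^ (size f).-1)) * k.+1 <= _)%N.
    by rewrite leq_mul2r leq_mul2l hf orbT.
  apply: leq_trans (_ : (k.+1 - M * M) * (k.+1 ^ (size f).-1 * k.+1) <= _)%N; last first.
    by rewrite leq_mul2l xx orbT.
  rewrite mulnA [X in (_ <= X)%N]mulnA !leq_mul2r.
  by apply/orP; right; apply/orP; right; move: kk1; rewrite /k1 /growth_start; clear; lia.
rewrite /growth_bound leq_add2l leq_mul //.
apply: abs_prod_nat_le => // [k kk1|]; last by rewrite muln_gt0 expn_gt0 /k1 /growth_start addn2.
apply: leq_trans (monic_upper fm sf cf (isT : (0 < k.+1)%N)) _.
rewrite leq_mul2l; apply/orP; right.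
apply: (@leq_trans (k1 ^ (size f).-1)%N); first exact: leq_exp_base.
by rewrite leq_pexp2l //; [clear -kk1; lia | clear -sf; lia].
Qed.

Section IndexBound.
Variables (K : fieldExtType rat) (M : nat).
Hypothesis dimK : \dim {: K} = 2%N.

Definition small_monic (p : {poly int}) : Prop :=
  [/\ p \is monic, (size p <= M)%N & forall i, (`|(p`_i)%R| <= M)%N].

Lemma size_prod_Qpoly (L : seq (int * int)) : size (\prod_(x <- L) Qpoly x) = (2 * size L).+1.
Proof.
elim: L => [|x L IH]; first by rewrite big_nil size_poly1.
rewrite big_cons size_mul ?IH ?size_Qpoly //=; first by clear; lia.
  by rewrite -size_poly_gt0 size_Qpoly.
by rewrite -size_poly_gt0 IH.
Qed.

(** At 1 and 2 each quadratic takes a divisor of the nonzero number [f(1) ^ 2] or [f(2) ^ 2]; these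
    two values determine its coefficients. *)
Lemma Qpoly_bounds (f : {poly int}) (L : seq (int * int)) : small_monic f ->
  (forall k : nat, f.[k.+1%:Z] != 0) -> f ^+ 2 = \prod_(x <- L) Qpoly x ->
  size L = (size f).-1 /\
  {in L, forall x, [/\ `|x.1| <= coef_bound M, `|x.2| <= coef_bound M,
     `|disc x| <= disc_bound M & forall k : nat, (0 < k)%N -> qval x k%:Z != 0]%N}.
Proof.
move=> [fm sf cf] f0 fE.
have df : (0 < size f)%N by rewrite size_poly_gt0 monic_neq0.
split.
  have := size_prod_Qpoly L; rewrite -fE expr2 size_mul ?monic_neq0 //.
  by move: df; move: (size f) (size L) => a b; clear; lia.
have fk k : f.[k%:Z] ^+ 2 = \prod_(x <- L) qval x k%:Z.
  by rewrite -horner_exp fE horner_prod; apply: eq_bigr => x _; rewrite horner_Qpoly.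
have dvd x k : x \in L -> (qval x k%:Z %| f.[k%:Z] ^+ 2)%Z.
  by move=> xL; rewrite fk (big_rem x) //= dvdz_mulr.
have V x k : x \in L -> (0 < k <= 2)%N ->
   (`|(qval x k%:Z)%R| <= ((1 + M * M) * 2 ^ M) ^ 2)%N.
  move=> xL /andP [k0 k2]; have fk0 : f.[k%:Z] != 0 by rewrite -(prednK k0).
  apply: leq_trans (dvdn_leq _ (dvd x k xL)) _; first by rewrite absz_gt0 expf_neq0.
  rewrite abszX leq_exp2r //; apply: leq_trans (monic_upper fm sf cf k0) _.
  rewrite leq_mul2l; apply/orP; right; apply: (@leq_trans (2 ^ (size f).-1)%N).
    exact: leq_exp_base.
  by rewrite leq_pexp2l //; clear -sf; lia.
move=> x xL.
have h1 := V x 1%N xL isT; have h2 := V x 2%N xL isT.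
move: h1 h2; rewrite /qval /quad; case: x xL => a c /= xL h1 h2.
have [b1 b2] : (`|a| <= coef_bound M)%N /\ (`|c| <= coef_bound M)%N.
  move: h1 h2; rewrite /coef_bound.
  move: (_ ^ 2)%N => X h1 h2.
  have e2 : 2%:Z ^+ 2 = 4 by [].
  rewrite expr1n in h1; rewrite e2 in h2.
  by clear -h1 h2; split; lia.
split=> //.
  rewrite /disc /disc_bound /=.
  have : (`|(a ^+ 2)%R| <= coef_bound M * coef_bound M)%N by rewrite expr2 abszM leq_mul.
  by clear -b2; lia.
move=> k k0; apply: contraNneq (f0 k.-1) => qk.
have {}qk : qval (a, c) k%:Z = 0 by [].
by rewrite prednK // -sqrf_eq0 fk (big_rem (a, c)) //= qk mul0r.
Qed.

Lemma prod_sqr (f : {poly int}) (L : seq (int * int)) n : f ^+ 2 = \prod_(x <- L) Qpoly x ->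
  \prod_(x <- L) qprod x n = (\prod_(0 <= k < n) f.[k.+1%:Z]) ^+ 2.
Proof.
move=> fE; rewrite -prodrXl exchange_big /=; apply: eq_bigr => k _.
by rewrite -horner_exp fE horner_prod; apply: eq_bigr => x _; rewrite horner_Qpoly.
Qed.

Lemma monic_sqr_inj (f g : {poly int}) : f \is monic -> g \is monic ->
  f ^+ 2 = g ^+ 2 -> f = g.
Proof.
move=> /monicP fm /monicP gm /eqP; rewrite eqf_sqr => /orP [/eqP //|/eqP fg].
by move: fm; rewrite fg lead_coefN gm => /eqP.
Qed.

(** The alternative [T1 = T2] means that the index 0 is already a solution. *)
Lemma same_degree_bound (f g : {poly int}) (T1 T2 : int) (n : nat) :
  splits_over K f -> splits_over K g -> small_monic f -> small_monic g ->
  (`|T1| <= M)%N -> (`|T2| <= M)%N -> T1 != 0 -> T2 != 0 ->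
  (forall k : nat, f.[k.+1%:Z] != 0) -> (forall k : nat, g.[k.+1%:Z] != 0) ->
  size f = size g ->
  T1 * \prod_(0 <= k < n) g.[k.+1%:Z] = T2 * \prod_(0 <= k < n) f.[k.+1%:Z] ->
  (n <= 2 ^ (2 * 3001 * disc_bound M ^ 2) + root_bound (disc_bound M))%N \/ T1 = T2.
Proof.
move=> fs gs fsm gsm T1M T2M T10 T20 f0 g0 sfg E.
have [fm sf cf] := fsm; have [gm sg cg] := gsm.
have [nsmall|nbig] := leqP n (2 ^ (2 * 3001 * disc_bound M ^ 2)).
  by left; apply: leq_trans nsmall _; apply: leq_addr.
have [LF FE HF] := square_factorization dimK fm fs.
have [LG GE HG] := square_factorization dimK gm gs.
have [szF bF] := Qpoly_bounds fsm f0 FE; have [szG bG] := Qpoly_bounds gsm g0 GE.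
set W := disc_bound M in nbig bF bG *.
have cW : (coef_bound M <= W)%N.
  by rewrite /W /disc_bound; move: (coef_bound M) (M * M)%N => X Y; clear; lia.
have M2W : (M * M <= W)%N by rewrite /W /disc_bound; clear; lia.
have M0 : (0 < M)%N by apply: leq_trans sf; rewrite size_poly_gt0 monic_neq0.
have MW : (M <= W)%N by apply: leq_trans M2W; rewrite leq_pmull.
have bFG : {in LF ++ LG, forall x, [/\ `|x.1| <= coef_bound M, `|x.2| <= coef_bound M,
     `|disc x| <= W & forall k : nat, (0 < k)%N -> qval x k%:Z != 0]%N}.
  by move=> x; rewrite mem_cat => /orP [/bF|/bG].
have qd : {in LF ++ LG, forall x, quadratic_disc K (disc x)}.
  by move=> x; rewrite mem_cat => /orP [/HF|/HG].
have E2 m : T1 * \prod_(0 <= k < m) g.[k.+1%:Z] = T2 * \prod_(0 <= k < m) f.[k.+1%:Z] ->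
  T1 ^+ 2 * \prod_(x <- LG) qprod x m = T2 ^+ 2 * \prod_(x <- LF) qprod x m.
  by rewrite (prod_sqr _ FE) (prod_sqr _ GE) -!exprMn => ->.
have sqW T : (`|T| <= M)%N -> (`|(T ^+ 2)%R| <= W)%N.
  by move=> h; apply: leq_trans M2W; rewrite expr2 abszM leq_mul.
have P : perm_eq (map disc LF) (map disc LG).
  apply: (disc_perm_eq Rdefinitions.R (T1 := T1 ^+ 2) (T2 := T2 ^+ 2) (W := W) (n := n)); rewrite ?expf_neq0 ?sqW //.
  - by rewrite szF szG sfg.
  - move=> x /bFG [b1 b2 b3 _]; split=> //; exact: leq_trans cW.
  - move=> x /qd [->|[d irr dE] _]; first by rewrite eqxx.
    exact: irrational_nsq irr dE.
  - by move=> x x' /qd qx /qd qx'; apply: quadratic_disc_sqr dimK _ _ qx qx'.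
  - by move=> x /bFG [_ _ _].
  - exact: ltnW.
  - exact: E2.
have [LG' PG discE] := perm_map_eq P.
have sub : {subset LF ++ LG' <= LF ++ LG}.
  by move=> x; rewrite !mem_cat (perm_mem PG).
have [||A [B [[sA sB] AB0 AB AbsAB]]] := telescope_seq (W := W) discE.
- by move=> x /sub/bFG [b1 b2 _ _]; split; apply: leq_trans cW.
- by move=> x /sub/bFG [_ _ _].
have {}AB m : (\prod_(x <- LG) qprod x m) * A.[m%:Z] = (\prod_(x <- LF) qprod x m) * B.[m%:Z].
  by rewrite -AB (perm_big _ PG).
have F0 m : \prod_(x <- LF) qprod x m != 0.
  rewrite (prod_sqr _ FE) expf_neq0 // prodf_seq_neq0; apply/allP => k _; exact: f0.
(* Telescoping turns the squared equation into the vanishing of this polynomial at the index. *)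
pose Q := T1 ^+ 2 *: B - T2 ^+ 2 *: A.
have Qh m : Q.[m%:Z] = T1 ^+ 2 * B.[m%:Z] - T2 ^+ 2 * A.[m%:Z] by rewrite !hornerE.
have Qn : Q.[n%:Z] = 0.
  apply/eqP; rewrite Qh subr_eq0; apply/eqP; apply: (mulfI (F0 n)).
  by rewrite mulrCA -AB mulrA (E2 n E); ring.
(* If [Q] is 0, the squared equation holds at every index: index 0 gives [T1 ^ 2 = T2 ^ 2],
   successive quotients give [f = g], and the original equation then fixes the sign. *)
have [Q0|Qn0] := eqVneq Q 0; [right|left].
  have Eall m : T1 ^+ 2 * \prod_(x <- LG) qprod x m = T2 ^+ 2 * \prod_(x <- LF) qprod x m.
    have := Qh m; rewrite Q0 horner0 => /esym/eqP; rewrite subr_eq0 => /eqP h.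
    have [Am0 _] := AB0 m; apply: (mulIf Am0).
    by rewrite -[LHS]mulrA AB mulrCA h; ring.
  have T12 : T1 ^+ 2 = T2 ^+ 2.
    have := Eall 0%N; rewrite (prod_sqr _ FE) (prod_sqr _ GE) !big_geq // expr1n !mulr1.
    by [].
  have Pall m : (\prod_(0 <= k < m) g.[k.+1%:Z]) ^+ 2 = (\prod_(0 <= k < m) f.[k.+1%:Z]) ^+ 2.
    have := Eall m; rewrite (prod_sqr _ FE) (prod_sqr _ GE) T12; apply: mulfI.
    by rewrite expf_neq0.
  have fg k : g.[k.+1%:Z] ^+ 2 = f.[k.+1%:Z] ^+ 2.
    have := Pall k.+1; rewrite !big_nat_recr //= !exprMn Pall; apply: mulfI.
    by rewrite expf_neq0 // prodf_seq_neq0; apply/allP => i _; exact: f0.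
  have fgE : f = g.
    apply: monic_sqr_inj => //; apply/eqP; rewrite -subr_eq0; apply/negPn/negP => d0.
    (* Agreement is known at positive integers only; the factor ['X] supplies the root 0. *)
    have /exists_nonroot [[|j] _] : (f ^+ 2 - g ^+ 2) * 'X != 0.
      by rewrite mulf_neq0 // polyX_eq0.
    - by rewrite hornerM hornerX mulr0 eqxx.
    - by rewrite hornerM hornerD hornerN !horner_exp fg subrr mul0r eqxx.
  move: E; rewrite fgE; apply: mulIf.
  by rewrite prodf_seq_neq0; apply/allP => i _; exact: g0.
apply: leq_trans (leq_addl _ _); apply: (int_root_bound Qn0 Qn).
  have lW : (size LF <= W)%N by rewrite szF; clear -sf MW; lia.
  have h : ((2 * W * size LF).+1 <= degree_bound W)%N.
    by rewrite /degree_bound addn1 ltnS leq_mul.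
  apply: leq_trans (size_polyD _ _) _; rewrite geq_max size_polyN.
  by rewrite !(leq_trans (size_scale_leq _ _)) // (leq_trans _ h).
move=> j jJ; rewrite Qh.
have lW : (size LF <= W)%N by rewrite szF; clear -sf MW; lia.
have mono : (telescope_bound W j ^ size LF <= telescope_bound W (degree_bound W) ^ W)%N.
  apply: (@leq_trans (telescope_bound W j ^ W)%N).
    by rewrite leq_pexp2l // telescope_bound_gt0.
  apply: leq_exp_base; apply: leq_exp_base; rewrite leq_mul2l; apply: leq_exp_base.
  by rewrite ltnS leq_add2r.
have [hA hB] := AbsAB j.
rewrite -[X in (_ <= X)%N]/(2 * (W * telescope_bound W (degree_bound W) ^ W))%N mul2n -addnn.
apply: leq_trans (absz_add_le _ _) _; rewrite abszN.
by apply: leq_add; rewrite abszM; apply: leq_mul; rewrite ?sqW //; apply: leq_trans mono.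
Qed.

Lemma index_bound_correct (f g : {poly int}) (T1 T2 : int) (n : nat) :
  splits_over K f -> splits_over K g -> small_monic f -> small_monic g ->
  (`|T1| <= M)%N -> (`|T2| <= M)%N ->
  (forall k : nat, f.[k.+1%:Z] != 0) ->
  T1 * \prod_(0 <= k < n) g.[k.+1%:Z] = T2 * \prod_(0 <= k < n) f.[k.+1%:Z] ->
  exists2 m, (m <= index_bound M)%N &
  T1 * \prod_(0 <= k < m) g.[k.+1%:Z] = T2 * \prod_(0 <= k < m) f.[k.+1%:Z].
Proof.
move=> fs gs fsm gsm T1M T2M f0 E.
have [fm sf cf] := fsm; have [gm sg cg] := gsm.
have F0 m : \prod_(0 <= k < m) f.[k.+1%:Z] != 0.
  by rewrite prodf_seq_neq0; apply/allP => i _; exact: f0.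
have [T10|T10] := eqVneq T1 0.
  move: E; rewrite T10 mul0r => /esym/eqP; rewrite mulf_eq0 (negbTE (F0 n)) orbF => /eqP ->.
  by exists 0%N => //; rewrite !mul0r.
have gb : (M * M <= index_bound M)%N.
  by rewrite /index_bound /growth_bound /growth_start; move: (M * M)%N => X; clear; lia.
(* Positive integer zeros of [g] are at most [M * M]. Beyond such a zero the left side vanishes, so
   a later solution forces [T2 = 0], and the index just past the zero is a solution too. *)
have [/existsP [k /eqP gk]|/existsPn gM] := boolP [exists k : 'I_(M * M), g.[k.+1%:Z] == 0].
  have [nk|kn] := leqP n k; first by exists n => //; apply: leq_trans nk (leq_trans (ltnW (ltn_ord k)) gb).
  have G0 m : (k < m)%N -> \prod_(0 <= k < m) g.[k.+1%:Z] = 0.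
    move=> km; rewrite (bigD1_seq (k : nat)) /= ?gk ?mul0r ?iota_uniq //.
    by rewrite mem_index_iota.
  exists k.+1; first exact: leq_trans (ltn_ord k) gb.
  move: E; rewrite !G0 // !mulr0 => /esym/eqP; rewrite mulf_eq0 (negbTE (F0 n)) orbF => /eqP ->.
  by rewrite mul0r.
have g0 k : g.[k.+1%:Z] != 0.
  apply/negP => /eqP gk; have kM := monic_pos_root gm sg cg (isT : (0 < k.+1)%N) gk.
  by have := gM (Ordinal kM); rewrite /= gk eqxx.
have G0 m : \prod_(0 <= k < m) g.[k.+1%:Z] != 0.
  by rewrite prodf_seq_neq0; apply/allP => i _; exact: g0.
have T20 : T2 != 0.
  by apply: contraNneq T10 => T20; move/eqP: E; rewrite T20 mul0r mulf_eq0 (negbTE (G0 n)) orbF.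
have growth_le : (growth_bound M <= index_bound M)%N by rewrite /index_bound -addnA leq_addr.
have [lt|lt|eq] := ltngtP (size f) (size g).
- by exists n => //; apply: leq_trans growth_le; apply: growth_case lt E.
- by exists n => //; apply: leq_trans growth_le; apply: growth_case lt (esym E).
have [nb|T12] := same_degree_bound fs gs fsm gsm T1M T2M T10 T20 f0 g0 eq E.
  by exists n => //; apply: leq_trans nb _; rewrite /index_bound -addnA leq_addl.
by exists 0%N => //; rewrite !big_geq // T12.
Qed.

End IndexBound.

(** * The algorithm *)

Lemma hypergeometric_prod (f g : {poly int}) (u0 : rat) (u : nat -> rat) (n : nat) :
  hypergeometric f g u0 u ->
  u n * (\prod_(0 <= k < n) f.[k.+1%:Z])%:~R = u0 * (\prod_(0 <= k < n) g.[k.+1%:Z])%:~R.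
Proof.
case=> u0E uS; elim: n => [|n IH]; first by rewrite !big_geq // u0E.
have /eqP := uS n.+1 isT; rewrite subr_eq0 /= => /eqP h.
rewrite !big_nat_recr //= !intrM mulrA mulrAC [u n.+1 * _]mulrC h -mulrA IH.
by rewrite mulrCA [_%:~R * _]mulrC.
Qed.

Lemma membershipP (f g : {poly int}) (u0 t : rat) : no_nat_zero f ->
  membership f g u0 t <-> exists n : nat,
    numq u0 * denq t * \prod_(0 <= k < n) g.[k.+1%:Z] =
    numq t * denq u0 * \prod_(0 <= k < n) f.[k.+1%:Z].
Proof.
move=> f0.
have key (u : nat -> rat) n : hypergeometric f g u0 u -> (u n = t <->
    numq u0 * denq t * \prod_(0 <= k < n) g.[k.+1%:Z] =
    numq t * denq u0 * \prod_(0 <= k < n) f.[k.+1%:Z]).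
  move=> /(@hypergeometric_prod _ _ _ _ n) E.
  set G := \prod_(0 <= k < n) g.[_] in E *; set F := \prod_(0 <= k < n) f.[_] in E *.
  have F0 : F%:~R != 0 :> rat.
    by rewrite intr_eq0 prodf_seq_neq0; apply/allP => k _; exact: f0.
  have d1 : (denq u0)%:~R != 0 :> rat by rewrite intr_eq0 denq_neq0.
  have d2 : (denq t)%:~R != 0 :> rat by rewrite intr_eq0 denq_neq0.
  have n1 : (numq u0)%:~R = u0 * (denq u0)%:~R by rewrite -{2}(divq_num_den u0) divfK.
  have n2 : (numq t)%:~R = t * (denq t)%:~R by rewrite -{2}(divq_num_den t) divfK.
  have E1 : (numq u0 * denq t * G)%:~R = u n * (F%:~R * (denq u0)%:~R * (denq t)%:~R).
    by rewrite !intrM n1 !mulrA E; ring.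
  have E2 : (numq t * denq u0 * F)%:~R = t * (F%:~R * (denq u0)%:~R * (denq t)%:~R).
    by rewrite !intrM n2; ring.
  split=> [un|/(congr1 (intr : int -> rat))].
    by apply: (@intr_inj rat); rewrite E1 E2 un.
  by rewrite E1 E2; apply: mulIf; rewrite !mulf_neq0.
split=> [[u [hu [n un]]]|[n En]]; first by exists n; apply/(key u n hu).
have [u [hu _]] := hypergeometric_exists_unique g u0 f0.
by exists u; split=> //; exists n; apply/(key u n hu).
Qed.

Section Decision.

(** A code bounds the length and the entries of its sequence. The sum therefore controls [f] and
    [g], and the product of the last two codes controls [numq u0 * denq t] and
    [numq t * denq u0]. *)
Definition code_bound (v : 4.-tuple nat) : nat :=
  (tnth v (inord 0) + tnth v (inord 1) + tnth v (inord 2) * tnth v (inord 3))%N.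

Definition code_entry (i j : nat) (v : 4.-tuple nat) : int :=
  decode_int (code_nth j (tnth v (inord i))).

Definition hits (n : nat) (v : 4.-tuple nat) : bool :=
  code_entry 2 0 v * code_entry 3 1 v * \prod_(k < n) eval_code (tnth v (inord 1)) k.+1 ==
  code_entry 3 0 v * code_entry 2 1 v * \prod_(k < n) eval_code (tnth v (inord 0)) k.+1.

Definition decision (v : 4.-tuple nat) : nat :=
  (0 < \sum_(n < (index_bound (code_bound v)).+1) hits n v)%N.

Lemma computable_index_bound n (a : n.-tuple nat -> nat) :
  computable a -> computable (fun v => index_bound (a v)).
Proof.
move=> ca; rewrite /index_bound /growth_bound /root_bound /telescope_bound /degree_bound.
rewrite /disc_bound /coef_bound /growth_start.
(* The constant case comes first, so that closed subterms such as [2 * 3001] are taken whole. *)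
by repeat lazymatch goal with
  | |- computable (fun _ => ?c) => exact: computable_const
  | |- computable (fun v => (@?x v + @?y v)%N) => apply: (@computable_add _ x y)
  | |- computable (fun v => (@?x v * @?y v)%N) => apply: (@computable_mul _ x y)
  | |- computable (fun v => (@?x v ^ @?y v)%N) => apply: (@computable_exp _ x y)
  | |- computable (fun v => (@?x v).+1) => apply: (@computable_S _ x)
  | |- _ => exact: ca
  end.
Qed.

Lemma computable_decision : computable decision.
Proof.
have cb : computable code_bound.
  apply: computable_add; last by apply: computable_mul; apply: computable_proj.
  by apply: computable_add; apply: computable_proj.
have ce i j : computableZ (fun w : 5.-tuple nat => code_entry i j [tuple of behead w]).
  apply: computable_decode; apply: computable_code_nth (computable_const _ j) _.
  exact: (computable_weaken (computable_proj (inord i : 'I_4))).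
have cp i : computableZ (fun w : 5.-tuple nat =>
    \prod_(k < thead w) eval_code (tnth [tuple of behead w] (inord i : 'I_4)) k.+1).
  apply: (computableZ_prod (b := fun w => thead w) (Z := fun k w => eval_code (tnth [tuple of behead w] (inord i : 'I_4)) k.+1)).
    exact: computable_fst.
  apply: computable_eval (computable_S (computable_fst _)).
  exact: (computable_weaken (computable_weaken (computable_proj (inord i : 'I_4)))).
apply: computable_pos.
apply: (computable_sum (F := fun n v => nat_of_bool (hits n v))).
  exact: computable_S (computable_index_bound cb).
by apply: computableZ_eq; apply: computableZ_mul (cp _); apply: computableZ_mul.
Qed.

End Decision.

Lemma code_int_ge (z : int) : (`|z| <= code_int z)%N.
Proof. by case: z => n /=; lia. Qed.

Lemma code_poly_size (f : {poly int}) : (size f <= code_poly f)%N.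
Proof. by rewrite -(size_map code_int); apply: code_size. Qed.

Lemma code_poly_coef (f : {poly int}) i : (`|(f`_i)%R| <= code_poly f)%N.
Proof.
have [lt|ge] := ltnP i (size f); last by rewrite nth_default.
apply: leq_trans (code_int_ge _) _; apply: code_mem.
by apply: map_f; apply: mem_nth.
Qed.

Lemma code_rat_num (q : rat) : (`|numq q| <= code_rat q)%N.
Proof. by apply: leq_trans (code_int_ge _) (code_mem _); rewrite inE eqxx. Qed.

Lemma code_rat_den (q : rat) : (`|denq q| <= code_rat q)%N.
Proof. by apply: leq_trans (code_int_ge _) (code_mem _); rewrite !inE eqxx orbT. Qed.

Lemma decision_correct (f g : {poly int}) (u0 t : rat) (K : fieldExtType rat) :
  no_nat_zero f -> f \is monic -> g \is monic ->
  \dim {: K} = 2%N -> splits_over K f -> splits_over K g ->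
  let input := [tuple code_poly f; code_poly g; code_rat u0; code_rat t] in
  (membership f g u0 t -> decision input = 1%N) /\
  (~ membership f g u0 t -> decision input = 0%N).
Proof.
move=> f0 fm gm dimK fs gs input.
have i0 : tnth input (inord 0) = code_poly f by rewrite (tnth_nth 0%N) inordK.
have i1 : tnth input (inord 1) = code_poly g by rewrite (tnth_nth 0%N) inordK.
have i2 : tnth input (inord 2) = code_rat u0 by rewrite (tnth_nth 0%N) inordK.
have i3 : tnth input (inord 3) = code_rat t by rewrite (tnth_nth 0%N) inordK.
have hitsE n : hits n input <-> numq u0 * denq t * \prod_(0 <= k < n) g.[k.+1%:Z] =
    numq t * denq u0 * \prod_(0 <= k < n) f.[k.+1%:Z].
  rewrite /hits /code_entry i0 i1 i2 i3 !code_nthE /= !code_intK !big_mkord.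
  under eq_bigr do rewrite eval_codeE.
  under [in X in _ == X]eq_bigr do rewrite eval_codeE.
  by split=> /eqP.
pose M := code_bound input.
have ME : M = (code_poly f + code_poly g + code_rat u0 * code_rat t)%N.
  by rewrite /M /code_bound i0 i1 i2 i3.
have fM : (code_poly f <= M)%N by rewrite ME -addnA leq_addr.
have gM : (code_poly g <= M)%N by rewrite ME addnAC leq_addl.
have fsm : small_monic M f.
  split=> // [|i]; apply: leq_trans fM; [exact: code_poly_size|exact: code_poly_coef].
have gsm : small_monic M g.
  split=> // [|i]; apply: leq_trans gM; [exact: code_poly_size|exact: code_poly_coef].
have T1M : (`|(numq u0 * denq t)%R| <= M)%N.
  rewrite abszM ME; apply: leq_trans (leq_addl _ _).
  by apply: leq_mul; [apply: code_rat_num | apply: code_rat_den].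
have T2M : (`|(numq t * denq u0)%R| <= M)%N.
  rewrite abszM ME mulnC; apply: leq_trans (leq_addl _ _).
  by apply: leq_mul; [apply: code_rat_den | apply: code_rat_num].
split=> [/(membershipP g u0 t f0) [n En]|nm].
  have [m mB Em] := index_bound_correct dimK fs gs fsm gsm T1M T2M (fun k => f0 k.+1) En.
  have mB' : (m < (index_bound (code_bound input)).+1)%N by [].
  rewrite /decision (bigD1 (Ordinal mB')) //=.
  by have /hitsE -> := Em.
rewrite /decision big1 // => n _; case: (boolP (hits n input)) => // /hitsE En.
by case: nm; apply/(membershipP g u0 t f0); exists (n : nat).
Qed.

Theorem theorem5p2 :
  exists A : recfun 4,
    forall (f g : {poly int}) (u0 t : rat),
      no_nat_zero f ->
      f \is monic -> g \is monic ->
      (exists K : fieldExtType rat,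
         [/\ \dim {: K} = 2%N, splits_over K f & splits_over K g]) ->
      let input := [tuple code_poly f; code_poly g; code_rat u0; code_rat t] in
      (membership f g u0 t -> computes A input 1%N) /\
      (~ membership f g u0 t -> computes A input 0%N).
Proof.
have [A HA] := computable_decision.
exists A => f g u0 t f0 fm gm [K [dimK fs gs]] input.
have [h1 h0] := decision_correct u0 t f0 fm gm dimK fs gs.
by split=> [/h1|/h0] E; have := HA input; rewrite E.
Qed.
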